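(* Let $-1<m<1<n$ and $0<\alpha\leq 1$. Then there exist positive constants $C$, $C'$, $\beta$ and $N_0$ (depending on $m,n,\alpha$ but not on $N$; the values of $C,C'$ may differ from one inequality to another) such that, for any $N>N_0$ and any minimizer $X_N$ of the energy functional $E$ over $\{y_1<\cdots<y_N\}$, the following hold. (A) (energy scaling law) $$CN^{1+\frac{(1-m)n\alpha}{n-m}}\leq E_N\leq C'N^{1+\frac{(1-m)n\alpha}{n-m}}\quad\text{if } -1<m<0;$$ $$\tfrac{(n-1)\alpha}{n}N^{1+\alpha}\log N-CN^{1+\alpha}\log\log N\leq E_N\leq \tfrac{(n-1)\alpha}{n}N^{1+\alpha}\log N+C'N^{1+\alpha}\quad\text{if } m=0,\ \alpha<1;$$ $$\tfrac{n-1}{2n}N^{2}\log N-CN^{2}\log\log N\leq E_N\leq \tfrac{n-1}{2n}N^{2}\log N+C'N^{2}\quad\text{if } m=0,\ \alpha=1;$$ $$-CN^{1+\frac{(1-m)n\alpha}{n-m}}\leq E_N\leq -C'N^{1+\frac{(1-m)n\alpha}{n-m}}\quad\text{if } 0<m<1.$$ (B) (minimal terrace length) $$CN^{-\frac{(1-m)\alpha}{n-m}}\leq\lambda_N\leq C'N^{-\frac{(1-m)\alpha}{n-m}}\quad\text{if } m\neq 0;\qquad CN^{-\frac{\alpha}{n}}(\log N)^{-\frac1n}\leq\lambda_N\leq C'N^{-\frac{\alpha}{n}}\quad\text{if } m=0.$$ (C) (system size) $$CN^{1-\frac{(1-m)\alpha}{n-m}}\leq w_N\leq C'N^{1-\beta}\quad\text{if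 } m\neq 0;\qquad CN^{1-\frac{\alpha}{n}}(\log N)^{-\frac1n}\leq w_N\leq C'N^{1-\beta}\quad\text{if } m=0.$$ In particular, $\lambda_N\ll 1$ (i.e. $\lambda_N\to 0$ as $N\to\infty$) and the system is in the bunching regime.
   Context: For real $-1<m<n$ (not necessarily integers) the pair potential is, for $x\neq 0$, $V(x)=-\frac1m|x|^{-m}+\frac1n|x|^{-n}$ if $m\neq0,n\neq 0$; $V(x)=\log|x|+\frac1n|x|^{-n}$ if $m=0<n$; $V(x)=-\frac1m|x|^{-m}-\log|x|$ if $m<n=0$. For $0\le\alpha\le1$ and a step configuration $Y_N=(y_1,\dots,y_N)$ with $y_1<\cdots<y_N$, the energy is $E[Y_N]=\sum_{1\le i<j\le N,\ j-i\le\lfloor N^\alpha\rfloor}V(y_j-y_i)$. The minimum energy is $E_N:=\min_{y_1<\cdots<y_N}E[Y_N]$; a minimizer is a configuration $X_N=(x_1,\dots,x_N)$, $x_1<\cdots<x_N$, with $E[X_N]=E_N$. For a configuration $X_N$: the minimal terrace length is $\lambda_N:=\min_{1\le i\le N-1}(x_{i+1}-x_i)$ and the system size is $w_N:=x_N-x_1$. A sequence of configurations $\{X_N\}$ is a bunching sequence if $\limsup_{N\to\infty}w_N/N=0$. The system with parameters $m,n,\alpha$ is in the bunching regime if every sequence of energy minimizers is a bunching sequence. *)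

(* Defs.v *)
From HB Require Import structures.
From mathcomp Require Import all_boot all_order all_algebra.
From mathcomp Require Import all_classical all_reals all_analysis.
From mathcomp Require Import ring lra.
Import Order.TTheory GRing.Theory Num.Theory.
Import numFieldNormedType.Exports.

Set Implicit Arguments.
Unset Strict Implicit.
Unset Printing Implicit Defensive.

Local Open Scope classical_set_scope.
Local Open Scope ring_scope.

Definition pair_potential (R : realType) (m n x : R) : R :=
  if m == 0 then ln `|x| + n^-1 * `|x| `^ (- n)
  else if n == 0 then - (m^-1 * `|x| `^ (- m)) - ln `|x|
  else - (m^-1 * `|x| `^ (- m)) + n^-1 * `|x| `^ (- n).

Definition step_config (R : realType) (N : nat) (Y : 'I_N -> R) : Prop :=
  forall i j : 'I_N, (i < j)%N -> Y i < Y j.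

Definition energy (R : realType) (m n alpha : R) (N : nat) (Y : 'I_N -> R) : R :=
  \sum_(i < N)
    \sum_(j < N | (i < j)%N &&
                  ((j - i)%N%:Z <= Num.floor (N%:R `^ alpha : R)))
      pair_potential m n (Y j - Y i).

(* An infimum; it is attained (min_energyP), hence a minimum. *)
Definition min_energy (R : realType) (m n alpha : R) (N : nat) : R :=
  inf [set energy m n alpha Y | Y in [set Y : 'I_N -> R | step_config Y]].

Definition minimizer (R : realType) (m n alpha : R) (N : nat)
    (X : 'I_N -> R) : Prop :=
  step_config X /\ energy m n alpha X = min_energy m n alpha N.

(* In 'I_k.+2, widen_ord (leqnSn k.+1) i and lift ord0 i have values i and
   i.+1; the value 0 for N < 2, where there is no terrace, is a convention. *)
Definition min_terrace (R : realType) (N : nat) : ('I_N -> R) -> R :=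
  if N is k.+2 then fun X =>
    let terrace (i : 'I_k.+1) :=
      X (lift ord0 i) - X (widen_ord (leqnSn k.+1) i) in
    \big[Num.min/terrace ord0]_(i < k.+1) terrace i
  else fun=> 0.

Definition system_size (R : realType) (N : nat) : ('I_N -> R) -> R :=
  if N is k.+1 then fun X => X ord_max - X ord0 else fun=> 0.

Definition bunching_sequence (R : realType) (X : forall N, 'I_N -> R) : Prop :=
  limn_esup (fun N => (system_size (X N) / N%:R)%:E) = 0%E.

Definition minimizer_sequence (R : realType) (m n alpha : R)
    (X : forall N, 'I_N -> R) : Prop :=
  forall N, minimizer m n alpha (X N).

Definition bunching_regime (R : realType) (m n alpha : R) : Prop :=
  forall X : forall N, 'I_N -> R,
    minimizer_sequence m n alpha X -> bunching_sequence X.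

Section Potential.
Variables (R : realType) (m n : R).
Hypotheses (mn : m < n) (n0 : 0 < n).

Let f (t : R) : R :=
  (if m == 0 then t else - (m^-1 * expR (- m * t))) + n^-1 * expR (- n * t).

Let Vf x : 0 < x -> pair_potential m n x = f (ln x).
Proof.
move=> x0; rewrite /pair_potential /f (gt_eqF n0) (gtr0_norm x0) /powR (gt_eqF x0).
by case: ifP.
Qed.

Let exp_is_derive (a t : R) : is_derive t 1 (fun t => expR (a * t)) (a * expR (a * t)).
Proof.
have Da : is_derive t 1 ( *%R a) a.
  by have := is_deriveZ a (is_derive_id t 1); rewrite [_ *: _]mulr1.
by rewrite mulrC; exact: (is_derive1_comp (is_derive_expR (a * t)) Da).
Qed.

Let f_is_derive (t : R) : is_derive t 1 f (expR (- m * t) - expR (- n * t)).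
Proof.
rewrite /f; have Dn := exp_is_derive (- n) t; have Dm := exp_is_derive (- m) t.
case: eqVneq => [m0|m0]; apply: is_derive_eq.
  rewrite /GRing.scale/= m0 oppr0 mul0r expR0.
  by field; rewrite gt_eqF.
by rewrite /GRing.scale/=; field; rewrite m0 gt_eqF.
Qed.

Let f_mono (t u : R) : 0 <= t -> t <= u -> f t <= f u.
Proof.
move=> t0 tu.
apply: (@ger0_derive1_ndecr _ f t u) => //.
- move=> x _; have Df := f_is_derive x; exact: ex_derive.
- move=> x /[!in_itv]/= /andP[tx _]; have Df := f_is_derive x.
  rewrite derive1E derive_val.
  have x0 : 0 < x by exact: le_lt_trans tx.
  by rewrite subr_ge0 ler_expR !mulNr lerN2 ler_wpM2r ?ltW.
- apply: continuous_subspaceT => x.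
  apply/differentiable_continuous/derivable1_diffP.
  have Df := f_is_derive x; exact: ex_derive.
Qed.

Let mu : R := Num.max m 0.
Let mun : mu < n. Proof. by rewrite /mu gt_max mn n0. Qed.

Let f_low (s : R) : 0 <= s -> f 0 + (n - mu) / 2 * s ^+ 2 <= f (- s).
Proof.
move=> s0.
pose g (t : R) : R := - f (- t) + (n - mu) / 2 * (t * t).
have Dg (t : R) : is_derive t 1 g
    ((expR (- m * - t) - expR (- n * - t)) + (n - mu) * t).
  have Df : is_derive t 1 (fun t => f (- t)) _ :=
    is_derive1_comp (f_is_derive (- t)) (is_deriveNid t 1).
  rewrite /g; apply: is_derive_eq.
  by rewrite /GRing.scale/=; field.
suff : g s <= g 0.
  by rewrite /g oppr0 !mulr0 addr0 expr2; lra.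
apply: (@ler0_derive1_nincr _ g 0 s) => //.
- move=> x /[!in_itv]/= /andP[x0 _]; have Dgx := Dg x; rewrite derive1E derive_val.
  rewrite !mulrNN.
  have h1 : expR (m * x) <= expR (mu * x).
    by rewrite ler_expR ler_wpM2r ?(ltW x0)// /mu le_max lexx.
  have mu0 : 0 <= mu by rewrite /mu le_max lexx orbT.
  have e1 : 1 <= expR (mu * x).
    by rewrite -[leLHS]expR0 ler_expR mulr_ge0// ltW.
  have e2 : 1 + (n - mu) * x <= expR ((n - mu) * x) by exact: expR_ge1Dx.
  have -> : n * x = mu * x + (n - mu) * x by ring.
  rewrite expRD.
  have : 0 <= (n - mu) * x by rewrite mulr_ge0 ?subr_ge0 ?ltW.
  nra.
- apply: continuous_subspaceT => x.
  apply/differentiable_continuous/derivable1_diffP.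
  exact: (@ex_derive _ _ _ _ _ _ _ (Dg x)).
Qed.

Lemma pair_potential_ndecr (x y : R) : 1 <= x -> x <= y ->
  pair_potential m n x <= pair_potential m n y.
Proof.
move=> x1 xy; have x0 : 0 < x by exact: lt_le_trans x1.
have y0 : 0 < y by exact: lt_le_trans xy.
rewrite !Vf//; apply: f_mono; first by rewrite ln_ge0.
by rewrite ler_ln.
Qed.

Lemma pair_potential_ge1 (x : R) : 0 < x ->
  pair_potential m n 1 <= pair_potential m n x.
Proof.
move=> x0; case: (leP 1 x) => [|x1]; first exact: pair_potential_ndecr.
rewrite !Vf// ln1.
have := @f_low (- ln x); rewrite opprK oppr_ge0 => /(_ (ln_le0 (ltW x1))).
by apply: le_trans; rewrite lerDl mulr_ge0 ?sqr_ge0// divr_ge0 ?subr_ge0 ?ltW.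
Qed.

Lemma pair_potential_barrier (B : R) : exists2 d : R, 0 < d <= 1 &
  forall x : R, 0 < x -> pair_potential m n x <= B -> d <= x.
Proof.
pose B' := Num.max 0 (B - f 0).
have B'0 : 0 <= B' by rewrite le_max lexx.
pose s := 1 + 2 * B' / (n - mu).
have nm : 0 < n - mu by rewrite subr_gt0.
have s1 : 1 <= s by rewrite lerDl divr_ge0 ?mulr_ge0 ?(ltW nm).
exists (expR (- s)).
  by rewrite expR_gt0 -[leRHS]expR0 ler_expR oppr_le0 (le_trans _ s1).
move=> x x0; rewrite Vf// => VB.
rewrite leNgt; apply/negP => xs.
have lx : s < - ln x.
  by rewrite ltrNr -[ltRHS]expRK ltr_ln ?posrE ?expR_gt0.
have sx : 0 <= - ln x by rewrite (le_trans _ (ltW lx))// (le_trans _ s1).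
have := f_low sx; rewrite opprK => h.
have BB : B - f 0 <= B' by rewrite le_max lexx orbT.
have sE : (n - mu) / 2 * (s - 1) = B' by rewrite /s; field; rewrite gt_eqF.
have : (n - mu) / 2 * (s - 1) < (n - mu) / 2 * (- ln x) ^+ 2.
  by rewrite ltr_pM2l ?divr_gt0//; nra.
lra.
Qed.

Lemma pair_potential_continuous (x : R) : 0 < x ->
  {for x, continuous (pair_potential m n)}.
Proof.
move=> x0.
have fc : {for ln x, continuous f}.
  apply/differentiable_continuous/derivable1_diffP.
  by have Df := f_is_derive (ln x); exact: ex_derive.
have h := continuous_comp (continuous_ln x0) fc.
suff : pair_potential m n y @[y --> x] --> f (ln x) by rewrite -Vf.
apply: cvg_trans h; apply: near_eq_cvg.
near=> y; rewrite /= Vf//; near: y; exact: lt_nbhsr.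
Unshelve. all: by end_near. Qed.
End Potential.

Section Existence.
Variables (R : realType) (m n alpha : R).
Hypotheses (mn : m < n) (n0 : 0 < n) (alpha0 : 0 <= alpha).

Let V : R -> R := pair_potential m n.
Let cvg_sumR (T : Type) (F : set_system T) (FF : Filter F) (I : Type)
    (r : seq I) (P : pred I) (G : I -> T -> R) (l : I -> R) :
  (forall i, P i -> G i x @[x --> F] --> l i) ->
  \sum_(i <- r | P i) G i x @[x --> F] --> \sum_(i <- r | P i) l i.
Proof.
move=> Gl; apply: cvg_big => //.
exact: add_continuous.
Qed.

Let rng (N : nat) (i j : nat) : bool :=
  (i < j)%N && ((j - i)%N%:Z <= Num.floor (N%:R `^ alpha : R)).

Let energyE N (Y : 'I_N -> R) :
  energy m n alpha Y = \sum_(i < N) \sum_(j < N | rng N i j) V (Y j - Y i).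
Proof. by []. Qed.

Let rng_succ N (i : nat) : (0 < N)%N -> rng N i i.+1.
Proof.
move=> N0; rewrite /rng ltnSn subSnn/= floor_ge_int /= -[X in X <= _](powRr0 N%:R).
by rewrite ler_powR// ler1n.
Qed.

Let cfg N (g : 'rV[R]_N.+1) : 'I_N.+1 -> R :=
  fun i => \sum_(0 <= k < i) g 0 (inord k).

Let cfg_sub N (g : 'rV[R]_N.+1) (i j : 'I_N.+1) : (i <= j)%N ->
  cfg g j - cfg g i = \sum_(i <= k < j) g 0 (inord k).
Proof.
by move=> ij; rewrite /cfg (big_cat_nat (n := i))//= addrAC subrr add0r.
Qed.

Let cfg_ge N (g : 'rV[R]_N.+1) (d : R) (i j : 'I_N.+1) :
  (forall k, d <= g 0 k) -> 0 <= d -> (i < j)%N -> d <= cfg g j - cfg g i.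
Proof.
move=> gd d0 ij; rewrite cfg_sub ?(ltnW ij)// (big_ltn ij).
by rewrite -[d]addr0 lerD// sumr_ge0// => k _; exact: le_trans (gd _).
Qed.

Let cfg_step N (g : 'rV[R]_N.+1) : (forall k, 0 < g 0 k) -> step_config (cfg g).
Proof.
move=> g0 i j ij; rewrite -subr_gt0 cfg_sub ?(ltnW ij)// (big_ltn ij).
by rewrite ltr_wpDr// sumr_ge0// => k _; rewrite ltW.
Qed.

Let box N (d : R) : set 'rV[R]_N.+1 := [set g | forall i, `[d, 1]%classic (g 0 i)].

Let box_min N (d : R) : 0 < d <= 1 -> exists2 g, @box N d g &
  forall h, @box N d h -> energy m n alpha (cfg g) <= energy m n alpha (cfg h).
Proof.
move=> /andP[d0 d1].
have bc : compact (@box N d).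
  apply: (@rV_compact _ _ (fun=> `[d, 1]%classic)) => _; exact: segment_compact.
have b0 : @box N d !=set0.
  by exists (const_mx 1) => i /=; rewrite mxE in_itv/= d1 lexx.
have [|g] := @compact_EVT_min _ R (fun g => energy m n alpha (cfg g)) _ b0 bc.
  apply: continuous_in_subspaceT => g; rewrite inE => gb.
  have ccfg i : cfg h i @[h --> g] --> cfg g i.
    by apply: (@cvg_sumR _ _ (nbhs_filter g)) => k _; exact: coord_continuous.
  rewrite /continuous_at energyE; apply: (@cvg_sumR _ _ (nbhs_filter g)) => i _; apply: (@cvg_sumR _ _ (nbhs_filter g)) => j /andP[ij _].
  apply: (@cvg_comp _ _ _ (fun h => cfg h j - cfg h i) V); first exact: cvgB.
  apply: pair_potential_continuous => //; apply: (lt_le_trans d0).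
  apply: (cfg_ge _ (ltW d0) ij) => k.
  by have := gb k; rewrite /= in_itv/= => /andP[].
by rewrite inE => gb gm; exists g => // h hb; apply: gm; rewrite inE.
Qed.

Lemma exists_energy_minimizer (N : nat) :
  exists2 X : 'I_N -> R, step_config X &
    forall Y : 'I_N -> R, step_config Y -> energy m n alpha X <= energy m n alpha Y.
Proof.
case: N => [|N].
  by exists (fun=> 0) => [[]|Y _]//; rewrite /energy !big_ord0.
pose E0 := energy m n alpha (cfg (const_mx 1 : 'rV[R]_N.+1)).
pose M : R := \sum_(i < N.+1) \sum_(j < N.+1 | rng N.+1 i j) V 1.
have [d /andP[d0 d1] dP] := pair_potential_barrier mn n0 (E0 - M + V 1).
have [g gb gm] : exists2 g, @box N d g & forall h, @box N d h ->
  energy m n alpha (cfg g) <= energy m n alpha (cfg h) by apply: box_min; rewrite d0.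
have g0 k : 0 < g 0 k.
  by have := gb k; rewrite /= in_itv/= => /andP[+ _]; exact: lt_le_trans.
exists (cfg g); first exact: cfg_step.
move=> Y Ystep; case: (leP (energy m n alpha Y) E0) => [YE|/ltW]; last first.
  apply: le_trans; apply: gm => k /=; by rewrite mxE in_itv/= d1 lexx.
pose y (k : nat) := Y (inord k).
pose h : 'rV[R]_N.+1 :=
  \row_(k < N.+1) if (k < N)%N then Num.min (y k.+1 - y k) 1 else 1.
have yS (k : nat) : (k < N)%N -> 0 < y k.+1 - y k.
  by move=> kN; rewrite subr_gt0; apply: Ystep; rewrite !inordK// ltnW.
have yd (k : nat) : (k < N)%N -> d <= y k.+1 - y k.
  move=> kN; apply: dP; first exact: yS.
  have : \sum_(i < N.+1) \sum_(j < N.+1 | rng N.+1 i j) (V (Y j - Y i) - V 1) <= E0 - M.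
    under eq_bigr do rewrite sumrB.
    by rewrite sumrB -energyE lerB.
  have Vge (i j : 'I_N.+1) : rng N.+1 i j -> 0 <= V (Y j - Y i) - V 1.
    move=> /andP[ij _]; rewrite subr_ge0; apply: pair_potential_ge1 => //.
    by rewrite subr_gt0; exact: Ystep.
  rewrite (bigD1 (inord k))//= (bigD1 (inord k.+1))/=; last first.
    by rewrite !inordK ?rng_succ// ltnW.
  move=> H; rewrite -[_ <= _ + V 1]lerBlDr; apply: le_trans H.
  rewrite -addrA lerDl addr_ge0//.
    by apply: sumr_ge0 => j /andP[? _]; exact: Vge.
  by apply: sumr_ge0 => i _; apply: sumr_ge0 => j; exact: Vge.
have hE (k : nat) : (k < N)%N -> h 0 (inord k) = Num.min (y k.+1 - y k) 1.
  by move=> kN; rewrite mxE inordK ?kN// ltnW.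
have hb : @box N d h.
  move=> k /=; rewrite mxE in_itv/=; case: ifP => kN; last by rewrite d1 lexx.
  by rewrite le_min yd// d1 ge_min lexx orbT.
apply: le_trans (gm h hb) _; rewrite !energyE.
apply: ler_sum => i _; apply: ler_sum => j /andP[ij _].
have h0 k : 0 < h 0 k.
  by have := hb k; rewrite /= in_itv/= => /andP[+ _]; exact: lt_le_trans.
have jN (k : nat) : (k < j)%N -> (k < N)%N.
  by move=> kj; rewrite (leq_trans kj)// -ltnS.
have Yij : Y j - Y i = \sum_(i <= k < j) (y k.+1 - y k).
  by rewrite telescope_sumr ?(ltnW ij)// /y !inord_val.
have hY : cfg h j - cfg h i <= Y j - Y i.
  rewrite Yij cfg_sub ?(ltnW ij)// ler_sum_nat// => k /andP[_ kj].
  by rewrite hE ?jN// ge_min lexx.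
have [allle|] := boolP [forall k : 'I_j, (i <= k)%N ==> (y k.+1 - y k <= 1)].
  suff -> : cfg h j - cfg h i = Y j - Y i by [].
  rewrite Yij cfg_sub ?(ltnW ij)//; apply: eq_big_nat => k /andP[ik kj].
  rewrite hE ?jN//; apply/min_idPl.
  by move/forallP/(_ (Ordinal kj))/implyP: allle; apply.
rewrite negb_forall => /existsP[k]; rewrite negb_imply -ltNge => /andP[ik yk].
apply: pair_potential_ndecr => //.
rewrite cfg_sub ?(ltnW ij)// (@big_cat_nat _ _ _ k)//=; last exact: ltnW.
rewrite (@big_ltn _ _ _ k)// hE ?jN// (min_idPr (ltW yk)).
rewrite addrCA lerDl addr_ge0// sumr_ge0// => l _; exact: ltW.
Qed.
End Existence.

Lemma min_energyP (R : realType) (m n alpha : R) (N : nat) :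
  m < n -> 0 < n -> 0 <= alpha ->
  (exists X : 'I_N -> R, minimizer m n alpha X) /\
  (forall X : 'I_N -> R, minimizer m n alpha X <-> step_config X /\
     forall Y : 'I_N -> R, step_config Y -> energy m n alpha X <= energy m n alpha Y).
Proof.
move=> mn n0 a0.
have minE (X : 'I_N -> R) : step_config X ->
    (forall Y : 'I_N -> R, step_config Y -> energy m n alpha X <= energy m n alpha Y) ->
    energy m n alpha X = min_energy m n alpha N.
  move=> sX Xm; apply/eqP; rewrite eq_le; apply/andP; split.
    apply: lb_le_inf; first by exists (energy m n alpha X), X.
    by move=> _ [Y sY <-]; exact: Xm.
  apply: ge_inf; last by exists X.
  by exists (energy m n alpha X) => _ [Y sY <-]; exact: Xm.
have [X sX Xm] := exists_energy_minimizer mn n0 a0 N.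
split; first by exists X; split=> //; exact: minE.
move=> Z; split=> [[sZ EZ]|[sZ Zm]]; split=> //; last exact: minE.
by move=> Y sY; rewrite EZ -(minE X)// Xm.
Qed.

(* Main.v *)
Require Import Defs.
From mathcomp Require Import all_boot all_order all_algebra.
From mathcomp Require Import all_classical all_reals all_analysis.
From mathcomp Require Import ring lra zify.
Import Order.TTheory GRing.Theory Num.Theory.
Import numFieldNormedType.Exports.

Set Implicit Arguments.
Unset Strict Implicit.
Unset Printing Implicit Defensive.

Local Open Scope classical_set_scope.
Local Open Scope ring_scope.

(** Let K be the integer part of N `^ alpha, so that step i interacts with step
    i + k for 1 <= k <= K, and split the potential into an attraction, a
    concave primitive of x `^ (- m - 1), and the repulsion x `^ (- n) / n. With
    constant gap t the repulsion is of order N t `^ (- n) and the attraction of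
    order N K `^ (1 - m) t `^ (- m); they balance at t of order
    K `^ (- (1 - m) / (n - m)). All the scaling laws compare a minimizer with
    uniform configurations at this scale.

    Upper bound on the energy: the uniform configuration
    ([seq_energy_uniform_le]). Lower bound ([seq_energy_ge_uniform]): every
    configuration has at least the attractive energy of the uniform
    configuration with gap t, for t a small multiple of the balancing gap.
    Indeed V is minimal at 1, hence after rescaling the attraction at distance
    d is at least its value at k t minus a multiple of (d / (k t)) `^ (- n); by
    convexity the latter is at most the mean over the gaps between the two
    steps, and since a gap lies in at most k windows of k gaps, all these errors
    together are paid by the repulsion between neighbours. This treats the
    three signs of m at once. If all gaps are at least lam, the energy is at
    least the attractive energy of gap lam; comparing with the upper bound
    gives the upper bound on the smallest gap.

    The other bounds come from the balance of forces ([gap_force0]): moving all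
    steps to the right of a gap rigidly does not change the energy of a
    minimizer to first order, so the forces of the pairs that straddle the gap
    sum to 0. At the smallest gap this bounds it from below
    ([minimizer_smallest_gap]), and hence the system size. No gap exceeds 1,
    for then all straddling pairs would attract ([minimizer_gap_le1]).

    For the upper bound on the system size, consider a gap of length at least
    del with L steps on either side. The L ^+ 2 pairs of these steps have
    length at most 2 L, which gives an attraction of order L `^ (1 - m), and only
    pairs closer than 2 repel enough to balance it. Therefore many steps, a
    positive power of L, lie within distance 2 of the gap ([crowding]). Double
    counting of pairs made of such a gap and a step near it shows that the
    crowded gaps have total length N divided by this power; the gaps smaller
    than del add at most N del, those near the ends at most 2 L
    ([minimizer_size_le]). With L a power of N smaller than K and del a small
    negative power of L, the size is at most N to a power smaller than 1. *)

(** * Real powers: tangent inequalities and power sums *)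

Section Powers.
Variable R : realType.
Implicit Types a t x y : R.

Lemma powR_expR a t : 0 < t -> t `^ a = expR (a * ln t).
Proof. by move=> t0; rewrite /powR gt_eqF. Qed.

Lemma powRDp x r s : 0 < x -> x `^ (r + s) = x `^ r * x `^ s.
Proof. by move=> x0; rewrite powRD// (gt_eqF x0) implybT. Qed.

Lemma powR_divl x y r : 0 < x -> 0 < y -> (x / y) `^ r = x `^ r * y `^ (- r).
Proof.
by move=> x0 y0; rewrite powRM ?invr_ge0 ?ltW// -powR_inv1 ?ltW// -powRrM mulN1r.
Qed.

Lemma le_powR_neg a x y : 0 <= a -> 0 < x -> x <= y -> y `^ (- a) <= x `^ (- a).
Proof.
move=> a0 x0 xy; have y0 : 0 < y by exact: lt_le_trans xy.
by rewrite !powR_expR// ler_expR !mulNr lerN2 ler_wpM2l// ler_ln.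
Qed.

Lemma le_powR_pos a x y : 0 <= a -> 0 <= x -> x <= y -> x `^ a <= y `^ a.
Proof.
move=> a0 x0 xy; apply: ge0_ler_powR => //; rewrite nnegrE//.
exact: le_trans xy.
Qed.

Lemma ge1_powR x a : 1 <= x -> 0 <= a -> 1 <= x `^ a.
Proof. by move=> x1 a0; rewrite -[leLHS](powRr0 x) ler_powR. Qed.

Lemma ln_le_sub1 t : 0 < t -> ln t <= t - 1.
Proof.
by move=> t0; rewrite -{1}(subrK 1 t) addrC le_ln1Dx// -subr_gt0; lra.
Qed.

Lemma powR_neg_ge_tangent a t : 0 <= a -> 0 < t -> 1 - a * (t - 1) <= t `^ (- a).
Proof.
move=> a0 t0; rewrite powR_expR//; apply: le_trans (expR_ge1Dx _).
by rewrite lerD2l mulNr lerN2 ler_wpM2l// ln_le_sub1.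
Qed.

(** With u = ln t, this is the convexity of expR between 0 and u, which follows
    from the tangent of expR at a * u. *)
Lemma powR_le_tangent a t : 0 <= a <= 1 -> 0 < t -> t `^ a <= 1 + a * (t - 1).
Proof.
move=> /andP[a0 a1] t0; rewrite powR_expR//.
rewrite -[X in _ * (X - 1)]lnK//; set u := ln t; set E := expR (a * u).
have E0 : 0 < E by exact: expR_gt0.
have h0 : E * (1 - a * u) <= 1.
  rewrite -[leRHS]expR0 -(subrr (a * u)) expRD ler_pM2l//; exact: expR_ge1Dx.
have h1 : E * (1 + (1 - a) * u) <= expR u.
  have {2}-> : u = a * u + (1 - a) * u by ring.
  by rewrite expRD ler_pM2l//; exact: expR_ge1Dx.
have h2 : (1 - a) * (E * (1 - a * u)) + a * (E * (1 + (1 - a) * u))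
    <= (1 - a) * 1 + a * expR u by rewrite lerD// ler_wpM2l// subr_ge0.
by apply: le_trans (le_trans h2 _); rewrite le_eqVlt; apply/orP; left; apply/eqP; ring.
Qed.

Lemma ln_le_powR a x : 0 < a -> 0 < x -> ln x <= a^-1 * x `^ a.
Proof.
move=> a0 x0; rewrite -ler_pdivrMl ?invr_gt0// invrK -ln_powR.
exact/ltW/ln_sublinear/powR_gt0.
Qed.

(** Telescoping: K `^ (1 - m) - (K - 1) `^ (1 - m) dominates a multiple of
    K `^ (- m). *)
Lemma sum_powR_le (m : R) (K : nat) : m < 1 ->
  \sum_(1 <= k < K.+1) k%:R `^ (- m) <= (Num.min 1 (1 - m))^-1 * K%:R `^ (1 - m).
Proof.
move=> m1; set a := Num.min 1 (1 - m).
have a0 : 0 < a by rewrite lt_min ltr01 subr_gt0.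
rewrite -ler_pdivrMl ?invr_gt0// invrK.
elim: K => [|K IH]; first by rewrite big_geq// mulr0 powR_ge0.
rewrite big_nat_recr//= mulrDr -lerBrDr; apply: le_trans IH _.
set x : R := K.+1%:R; have x0 : 0 < x by rewrite ltr0n.
have -> : K%:R = x * (1 - x^-1).
  by rewrite mulrBr mulr1 divff ?gt_eqF// /x -natr1 addrK.
have xi1 : x^-1 <= 1 by rewrite invf_le1// ler1n.
have xi0 : 0 < x^-1 by rewrite invr_gt0.
have -> : x `^ (- m) = x `^ (1 - m) * x^-1.
  by rewrite -powR_inv1 ?(ltW x0)// -powRDp//; congr (_ `^ _); ring.
rewrite powRM ?(ltW x0) ?subr_ge0//.
have -> : x `^ (1 - m) - a * (x `^ (1 - m) * x^-1)
    = x `^ (1 - m) * (1 - a * x^-1) by ring.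
rewrite ler_wpM2l ?powR_ge0//.
have [->|xn1] := eqVneq x^-1 1.
  by rewrite subrr mulr1 powR0 ?gt_eqF ?subr_gt0// subr_ge0 ge_min lexx.
have y0 : 0 < 1 - x^-1 by rewrite subr_gt0 lt_neqAle xn1.
rewrite /a; case: (leP 1 (1 - m)) => h.
  by rewrite mul1r ge1r_powR// y0 gerBl ltW.
have : 0 <= 1 - m <= 1 by lra.
move/powR_le_tangent => /(_ _ y0).
by have -> : 1 + (1 - m) * (1 - x^-1 - 1) = 1 - (1 - m) * x^-1 by ring.
Qed.

(** Telescoping again, with the convex power 1 - n < 0. *)
Lemma sum_powR_lt (n : R) (K : nat) : 1 < n ->
  \sum_(1 <= k < K.+1) k%:R `^ (- n) <= n / (n - 1).
Proof.
move=> n1; have n10 : 0 < n - 1 by rewrite subr_gt0.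
suff H : forall K, \sum_(1 <= k < K.+2) k%:R `^ (- n)
    <= n / (n - 1) - K.+1%:R `^ (1 - n) / (n - 1).
  case: K => [|K]; first by rewrite big_geq// divr_ge0 ?ltW//; lra.
  by apply: le_trans (H K) _; rewrite gerBl divr_ge0 ?powR_ge0// ltW.
elim=> [|{}K IH].
  rewrite big_nat1 !powR1 -mulrBl divff ?gt_eqF//.
rewrite big_nat_recr//=; apply: le_trans (lerD IH (lexx _)) _.
set x : R := K.+2%:R; have x0 : 0 < x by rewrite ltr0n.
have -> : K.+1%:R = x * (1 - x^-1).
  by rewrite mulrBr mulr1 divff ?gt_eqF// /x -[in RHS]natr1 addrK.
have xi1 : x^-1 < 1 by rewrite invf_lt1// ltr1n.
have -> : x `^ (- n) = x `^ (1 - n) * x^-1.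
  by rewrite -powR_inv1 ?(ltW x0)// -powRDp//; congr (_ `^ _); ring.
rewrite powRM ?(ltW x0) ?subr_ge0 ?(ltW xi1)//.
have y0 : 0 < 1 - x^-1 by rewrite subr_gt0.
have := @powR_neg_ge_tangent (n - 1) (1 - x^-1) (ltW n10) y0; rewrite opprB.
have -> : 1 - (n - 1) * (1 - x^-1 - 1) = 1 + (n - 1) * x^-1 by ring.
move=> h; set P := x `^ (1 - n); have P0 : 0 <= P by exact: powR_ge0.
rewrite -addrA lerD2l addrC -subr_le0.
have -> : P * x^-1 - P * (1 - x^-1) `^ (1 - n) / (n - 1) - - (P / (n - 1))
  = P / (n - 1) * (1 + (n - 1) * x^-1 - (1 - x^-1) `^ (1 - n)).
  by field; rewrite !gt_eqF.
by rewrite mulr_ge0_le0 ?divr_ge0 ?(ltW n10)// subr_le0.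
Qed.

End Powers.

(** * The pair potential *)

Section Potential.
Variables (R : realType) (m n : R).

(** The attractive part of the potential: the primitive of x `^ (- m - 1)
    that the pair potential uses. *)
Definition attraction (t : R) : R :=
  if m == 0 then ln t else - (m^-1 * t `^ (- m)).

Lemma pair_potential_split (x : R) : n != 0 -> 0 < x ->
  pair_potential m n x = attraction x + n^-1 * x `^ (- n).
Proof.
move=> n0 x0; rewrite /pair_potential /attraction gtr0_norm// (negPf n0).
by case: ifP.
Qed.

Lemma attraction_scale (s u : R) : 0 < s -> 0 < u ->
  attraction (s * u) - attraction s = s `^ (- m) * (attraction u - attraction 1).
Proof.
move=> s0 u0; rewrite /attraction; case: eqVneq => [->|m0].
  by rewrite oppr0 powRr0 lnM// ln1; ring.
by rewrite powRM ?ltW// powR1; ring.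
Qed.

Lemma attraction_ge1 (x : R) : m < n -> 0 < n -> 0 < x ->
  attraction 1 + n^-1 * (1 - x `^ (- n)) <= attraction x.
Proof.
move=> mn n0 x0; have := pair_potential_ge1 mn n0 x0.
by rewrite !pair_potential_split ?gt_eqF// powR1; lra.
Qed.

(** Since V is minimal at 1, the attraction is at least a constant minus the
    repulsion, with equality at 1; scaling moves the point of contact to s. *)
Lemma attraction_ge_contact (s d : R) : m < n -> 0 < n -> 0 < s -> 0 < d ->
  attraction s + s `^ (- m) * (n^-1 * (1 - (d / s) `^ (- n))) <= attraction d.
Proof.
move=> mn n0 s0 d0; have u0 : 0 < d / s by rewrite divr_gt0.
have := attraction_scale s0 u0; rewrite mulrC divfK ?gt_eqF// => E.
rewrite -lerBrDl E ler_wpM2l ?powR_ge0// lerBrDl.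
exact: attraction_ge1.
Qed.

Lemma is_derive_attraction (x : R) : 0 < x -> is_derive x 1 attraction (x `^ (- m - 1)).
Proof.
move=> x0; rewrite /attraction; have [->|m0] := eqVneq m 0.
  have := is_derive1_ln x0; rewrite oppr0 sub0r powR_inv1 ?ltW//.
have D := is_derive1_powR (- m) x0.
have -> : (fun t : R => - (m^-1 * t `^ (- m))) = (- m^-1) \*: (fun t : R => t `^ (- m)).
  by apply/funext => t; rewrite /= /GRing.scale/= mulNr.
apply: is_derive_eq; rewrite /GRing.scale/=.
by rewrite mulrA mulrNN mulVf ?mul1r.
Qed.

Lemma is_derive_pair_potential (x : R) : n != 0 -> 0 < x ->
  is_derive x 1 (pair_potential m n) (x `^ (- m - 1) - x `^ (- n - 1)).
Proof.
move=> n0 x0; have Da := is_derive_attraction x0.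
have Dp := is_derive1_powR (- n) x0.
have D : is_derive x 1 (attraction + n^-1 \*: (fun t : R => t `^ (- n)))
    (x `^ (- m - 1) - x `^ (- n - 1)).
  by apply: is_derive_eq; rewrite /GRing.scale/= mulrA mulrN mulVf// mulN1r.
apply: (near_eq_is_derive _ D).
near=> y; rewrite pair_potential_split// .
near: y; exact: lt_nbhsr.
Unshelve. all: by end_near. Qed.

Lemma attraction_le (x y : R) : 0 < x -> x <= y -> attraction x <= attraction y.
Proof.
move=> x0 xy; have y0 := lt_le_trans x0 xy.
rewrite /attraction; case: eqVneq => [_|m0]; first by rewrite ler_ln.
rewrite lerN2; have [mp|mn] := ltP 0 m.
  by rewrite ler_wpM2l ?invr_ge0 ?(ltW mp)// le_powR_neg// ltW.
by rewrite ler_wnM2l ?invr_le0// le_powR_pos ?oppr_ge0// ltW.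
Qed.

End Potential.

(** * Sums over pairs of steps *)

Section PairSums.
Variable R : realType.
Implicit Types (F : nat -> nat -> R) (N K : nat).

(** The outer index is the distance k between the indices of a pair, so that the
    inner sum is over translates of a window of k gaps. *)
Definition pair_sum N K F : R :=
  \sum_(1 <= k < K.+1) \sum_(0 <= i < N - k) F k i.

Lemma pair_sumE N K (f : nat -> nat -> R) :
  pair_sum N K (fun k i => f i (i + k)%N)
  = \sum_(0 <= i < N) \sum_(0 <= j < N | (i < j)%N && (j - i <= K)%N) f i j.
Proof.
rewrite /pair_sum.
transitivity (\sum_(0 <= i < N) \sum_(1 <= k < K.+1 | (k < N - i)%N) f i (i + k)%N).
  rewrite [RHS](exchange_big_dep_nat xpredT)//=; apply: eq_big_nat => k _.
  rewrite [LHS](big_nat_widen _ _ N) ?leq_subr//=; apply: eq_bigl => i; lia.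
apply: eq_big_nat => i /= iN.
rewrite [RHS](big_cat_nat (n := i.+1))//= [X in _ = X + _]big_nat_cond
  [X in _ = X + _]big1 ?add0r; last by move=> j; lia.
rewrite -{1}[i.+1]add1n [RHS]big_addn.
rewrite [RHS](big_nat_widen _ _ (N - i + K.+1))//=; last lia.
rewrite [LHS](big_nat_widen _ _ (N - i + K.+1))//=; last lia.
rewrite big_nat_cond [RHS]big_nat_cond; by apply: eq_big => [k|k _]; [lia|rewrite addnC].
Qed.

Lemma eq_pair_sum N K F G : (forall k i, (0 < k <= K)%N -> (i + k < N)%N -> F k i = G k i) ->
  pair_sum N K F = pair_sum N K G.
Proof.
move=> FG; apply: eq_big_nat => k /andP[k0 kK]; apply: eq_big_nat => i iN.
by apply: FG; lia.
Qed.

Lemma le_pair_sum N K F G : (forall k i, (0 < k <= K)%N -> (i + k < N)%N -> F k i <= G k i) ->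
  pair_sum N K F <= pair_sum N K G.
Proof.
move=> FG; apply: ler_sum_nat => k /andP[k0 kK]; apply: ler_sum_nat => i iN.
by apply: FG; lia.
Qed.

Lemma pair_sum_ge0 N K F : (forall k i, (0 < k <= K)%N -> (i + k < N)%N -> 0 <= F k i) ->
  0 <= pair_sum N K F.
Proof.
move=> F0; rewrite /pair_sum big_nat sumr_ge0// => k /andP[k0 kK].
by rewrite big_nat sumr_ge0// => i iN; apply: F0; lia.
Qed.

Lemma pair_sumD N K F G :
  pair_sum N K (fun k i => F k i + G k i) = pair_sum N K F + pair_sum N K G.
Proof. by rewrite /pair_sum -big_split; apply: eq_bigr => k _; rewrite -big_split. Qed.

Lemma pair_sumN N K F : pair_sum N K (fun k i => - F k i) = - pair_sum N K F.
Proof. by rewrite /pair_sum -sumrN; apply: eq_bigr => k _; rewrite -sumrN. Qed.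

Lemma pair_sumZ N K (c : R) F : pair_sum N K (fun k i => c * F k i) = c * pair_sum N K F.
Proof. by rewrite /pair_sum mulr_sumr; apply: eq_bigr => k _; rewrite mulr_sumr. Qed.

Lemma pair_sum_cst N K (f : nat -> R) :
  pair_sum N K (fun k _ => f k) = \sum_(1 <= k < K.+1) (N - k)%:R * f k.
Proof. by apply: eq_bigr => k _; rewrite sumr_const_nat subn0 mulr_natl. Qed.

Lemma pair_sum_ge_nearest N K F : (0 < K)%N ->
  (forall k i, (0 < k <= K)%N -> (i + k < N)%N -> 0 <= F k i) ->
  \sum_(0 <= i < N - 1) F 1%N i <= pair_sum N K F.
Proof.
move=> K0 F0; rewrite /pair_sum [leRHS]big_ltn// lerDl big_nat sumr_ge0// => k /andP[k0 kK].
by rewrite big_nat sumr_ge0// => i iN; apply: F0; lia.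
Qed.

Lemma pair_sum_ge_term N K F k i : (0 < k <= K)%N -> (i + k < N)%N ->
  (forall k i, (0 < k <= K)%N -> (i + k < N)%N -> 0 <= F k i) ->
  F k i <= pair_sum N K F.
Proof.
move=> /andP[k0 kK] ikN F0.
rewrite /pair_sum (bigD1_seq k) ?iota_uniq ?mem_index_iota//=; last lia.
rewrite (bigD1_seq i) ?iota_uniq ?mem_index_iota//=; last lia.
rewrite -addrA lerDl addr_ge0// big_seq_cond sumr_ge0// => j.
  by rewrite mem_index_iota => ?; apply: F0; lia.
rewrite mem_index_iota => ?; rewrite big_seq sumr_ge0// => i'.
by rewrite mem_index_iota => ?; apply: F0; lia.
Qed.

(** A window of k consecutive gaps can be placed over a given gap in at most k
    ways, so averaging over windows and then summing over their positions
    counts each gap at most once. *)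
Lemma sum_window_average_le N (k : nat) (h : nat -> R) : (0 < k)%N ->
  (forall l, 0 <= h l) ->
  \sum_(0 <= i < N - k) k%:R^-1 * \sum_(i <= l < i + k) h l
    <= \sum_(0 <= l < N - 1) h l.
Proof.
move=> k0 h0; rewrite -mulr_sumr ler_pdivrMl ?ltr0n//.
under eq_bigr => i _.
  rewrite -{1}[i]add0n big_addn addKn; over.
rewrite exchange_big_nat/= mulr_natl -[k in leRHS]subn0 -sumr_const_nat.
apply: ler_sum_nat => r /andP[_ rk].
have -> : \sum_(0 <= i < N - k) h (r + i)%N = \sum_(r <= l < N - k + r) h l.
  rewrite -{2}[r]add0n big_addn addnK; apply: eq_bigr => i _.
  by rewrite addnC.
have [Nk|Nk] := leqP (N - k) 0; first by rewrite [leLHS]big_geq ?sumr_ge0//; lia.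
rewrite (@big_cat_nat _ _ _ r 0)//=; last lia.
rewrite (@big_cat_nat _ _ _ (N - k + r) r (N - 1))//=; [|lia|lia].
by rewrite addrCA lerDl addr_ge0 ?sumr_ge0.
Qed.

End PairSums.

(** * Energy of an increasing sequence *)

Section Increasing.
Variables (R : realType) (y : nat -> R).

Lemma distance_sum_gap i k : y (i + k)%N - y i = \sum_(i <= l < i + k) (y l.+1 - y l).
Proof. by rewrite telescope_sumr// leq_addr. Qed.

Lemma distance_ge N (lam : R) i k : (forall l, (l.+1 < N)%N -> lam <= y l.+1 - y l) ->
  (i + k < N)%N -> k%:R * lam <= y (i + k)%N - y i.
Proof.
move=> ge ikN; rewrite distance_sum_gap -[k in leLHS](addKn i k) mulr_natl -sumr_const_nat.
by apply: ler_sum_nat => l /andP[_ lk]; apply: ge; lia.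
Qed.

Hypothesis y_incr : {homo y : i j / (i < j)%N >-> i < j}.

Lemma gap_gt0 l : 0 < y l.+1 - y l.
Proof. by rewrite subr_gt0 y_incr. Qed.

Lemma increasing_le i j : (i <= j)%N -> y i <= y j.
Proof. by rewrite leq_eqVlt => /orP[/eqP->//|/y_incr/ltW]. Qed.

Lemma distance_gt0 i k : (0 < k)%N -> 0 < y (i + k)%N - y i.
Proof. by move=> k0; rewrite subr_gt0 y_incr// -[ltnLHS]addn0 ltn_add2l. Qed.

End Increasing.

Section SeqEnergy.
Variable R : realType.
Variables (m n : R) (N K : nat).
Hypotheses (mn : m < n) (n0 : 0 < n).

Definition seq_energy (y : nat -> R) : R :=
  pair_sum N K (fun k i => pair_potential m n (y (i + k)%N - y i)).

(** The attractive energy of the configuration with constant gap t. *)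
Definition uniform_attraction (t : R) : R :=
  \sum_(1 <= k < K.+1) (N - k)%:R * attraction m (k%:R * t).

Section LowerBounds.
Variable y : nat -> R.
Hypothesis y_incr : {homo y : i j / (i < j)%N >-> i < j}.

Lemma seq_energy_split : seq_energy y
  = pair_sum N K (fun k i => attraction m (y (i + k)%N - y i))
    + n^-1 * pair_sum N K (fun k i => (y (i + k)%N - y i) `^ (- n)).
Proof.
rewrite -pair_sumZ -pair_sumD; apply: eq_pair_sum => k i /andP[k0 _] _.
by rewrite pair_potential_split ?gt_eqF// (distance_gt0 y_incr).
Qed.

(** Jensen's inequality for x `^ (- n), by summing its tangent inequality at
    the mean gap. *)
Lemma mean_gap_powR_neg i k : (0 < k)%N ->
  ((y (i + k)%N - y i) / k%:R) `^ (- n)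
    <= k%:R^-1 * \sum_(i <= l < i + k) (y l.+1 - y l) `^ (- n).
Proof.
move=> k0; have kR : (0 : R) < k%:R by rewrite ltr0n.
set a := _ / k%:R; have a0 : 0 < a by rewrite divr_gt0 ?distance_gt0.
rewrite ler_pdivlMl//.
have -> : k%:R * a `^ (- n) = \sum_(i <= l < i + k) a `^ (- n) * (1 - n * ((y l.+1 - y l) / a - 1)).
  rewrite -mulr_sumr sumrB sumr_const_nat addKn -mulr_sumr sumrB -mulr_suml.
  rewrite -distance_sum_gap sumr_const_nat addKn.
  have -> : y (i + k)%N - y i = k%:R * a by rewrite mulrC divfK ?gt_eqF.
  by rewrite -mulrA divff ?gt_eqF// mulr1 subrr mulr0 subr0 mulrC.
apply: ler_sum => l _; have gl := gap_gt0 y_incr l.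
have {2}-> : y l.+1 - y l = a * ((y l.+1 - y l) / a) by rewrite mulrC divfK ?gt_eqF.
have u0 : 0 < (y l.+1 - y l) / a by rewrite divr_gt0.
by rewrite [in leRHS]powRM ?(ltW a0) ?(ltW u0)// ler_wpM2l ?powR_ge0// powR_neg_ge_tangent ?(ltW n0).
Qed.

(** Below each attractive term put its contact bound at distance k * t. The
    repulsive error terms sum up, by Jensen and window counting, to at most the
    repulsion between neighbours, provided t is so small that the uniform
    attraction force at gap t does not exceed the repulsion force. *)
Lemma seq_energy_ge_uniform (t : R) : (0 < K)%N -> 0 < t ->
  t `^ (n - m) * \sum_(1 <= k < K.+1) k%:R `^ (- m) <= 1 ->
  uniform_attraction t <= seq_energy y.
Proof.
move=> K0 t0 tS; pose G := \sum_(0 <= l < N - 1) (y l.+1 - y l) `^ (- n).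
have G0 : 0 <= G by apply: sumr_ge0 => l _; exact: powR_ge0.
have repG : G <= pair_sum N K (fun k i => (y (i + k)%N - y i) `^ (- n)).
  apply: le_trans (pair_sum_ge_nearest K0 _); last by move=> *; exact: powR_ge0.
  by apply: ler_sum => l _; rewrite addn1.
have attr : uniform_attraction t - n^-1 * G
    <= pair_sum N K (fun k i => attraction m (y (i + k)%N - y i)).
  apply: (@le_trans _ _ (pair_sum N K (fun k i => attraction m (k%:R * t)
      + - (n^-1 * (t `^ (n - m) * (k%:R `^ (- m)
           * (k%:R^-1 * \sum_(i <= l < i + k) (y l.+1 - y l) `^ (- n)))))))).
    rewrite pair_sumD pair_sum_cst lerD2l pair_sumN lerN2 pair_sumZ.
    rewrite ler_wpM2l ?invr_ge0 ?(ltW n0)// pair_sumZ.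
    apply: le_trans (_ : t `^ (n - m) * (\sum_(1 <= k < K.+1) k%:R `^ (- m) * G) <= _).
      rewrite ler_wpM2l ?powR_ge0//; apply: ler_sum_nat => k /andP[k0 _].
      rewrite -mulr_sumr ler_wpM2l ?powR_ge0//.
      by apply: sum_window_average_le => // l; exact: powR_ge0.
    by rewrite -mulr_suml mulrA ler_piMl.
  apply: le_pair_sum => k i /andP[k0 _] _.
  have kR : (0 : R) < k%:R by rewrite ltr0n.
  have d0 := distance_gt0 y_incr i k0; set d := y (i + k)%N - y i in d0 *.
  have kt0 : 0 < k%:R * t by rewrite mulr_gt0.
  apply: le_trans (attraction_ge_contact mn n0 kt0 d0); rewrite lerD2l.
  have J := mean_gap_powR_neg i k0; rewrite -/d in J.
  set W := k%:R^-1 * _ in J *.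
  have -> : (d / (k%:R * t)) `^ (- n) = t `^ n * (d / k%:R) `^ (- n).
    have -> : d / (k%:R * t) = (d / k%:R) / t by field; rewrite !gt_eqF.
    by rewrite powR_divl ?divr_gt0// opprK mulrC.
  rewrite powRM ?ler0n ?(ltW t0)//.
  have -> : t `^ (n - m) = t `^ (- m) * t `^ n by rewrite -powRDp// addrC.
  rewrite -mulrN [leRHS]mulrCA ler_wpM2l ?invr_ge0 ?(ltW n0)//.
  set P := k%:R `^ (- m); set Q := t `^ (- m); set T := t `^ n.
  have PQ : 0 <= P * Q by rewrite mulr_ge0 ?powR_ge0.
  have TJ : T * (d / k%:R) `^ (- n) <= T * W by rewrite ler_wpM2l ?powR_ge0.
  have -> : - (Q * T * (P * W)) = P * Q * (- (T * W)) by ring.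
  by rewrite ler_wpM2l//; lra.
rewrite seq_energy_split.
have : n^-1 * G <= n^-1 * pair_sum N K (fun k i => (y (i + k)%N - y i) `^ (- n)).
  by rewrite ler_wpM2l ?invr_ge0 ?(ltW n0).
lra.
Qed.

Lemma seq_energy_ge_uniform_of_gaps (lam : R) : 0 < lam ->
  (forall l, (l.+1 < N)%N -> lam <= y l.+1 - y l) ->
  uniform_attraction lam <= seq_energy y.
Proof.
move=> lam0 ge; rewrite seq_energy_split.
rewrite -[leLHS]addr0 lerD//; last first.
  by rewrite mulr_ge0 ?invr_ge0 ?(ltW n0)// pair_sum_ge0// => *; exact: powR_ge0.
rewrite /uniform_attraction -pair_sum_cst; apply: le_pair_sum => k i /andP[k0 _] ikN.
by apply: attraction_le; rewrite ?mulr_gt0 ?ltr0n// (distance_ge ge).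
Qed.

End LowerBounds.

Lemma seq_energy_uniform_le (t : R) : 1 < n -> 0 < t ->
  seq_energy (fun i => i%:R * t) <= uniform_attraction t + (n - 1)^-1 * (N%:R * t `^ (- n)).
Proof.
move=> n1 t0; rewrite seq_energy_split; last first.
  by move=> i j ij; rewrite ltr_pM2r// ltr_nat.
have dE (k i : nat) : (i + k)%N%:R * t - i%:R * t = k%:R * t by rewrite natrD; ring.
have -> : pair_sum N K (fun k i => attraction m ((i + k)%:R * t - i%:R * t))
    = uniform_attraction t.
  rewrite /uniform_attraction -pair_sum_cst.
  by apply: eq_pair_sum => k i _ _; rewrite dE.
have -> : pair_sum N K (fun k i => ((i + k)%:R * t - i%:R * t) `^ (- n))
    = \sum_(1 <= k < K.+1) (N - k)%:R * (k%:R * t) `^ (- n).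
  by rewrite -pair_sum_cst; apply: eq_pair_sum => k i _ _; rewrite dE.
rewrite lerD2l.
have n10 : 0 < n - 1 by rewrite subr_gt0.
have -> : (n - 1)^-1 * (N%:R * t `^ (- n)) = n^-1 * (N%:R * t `^ (- n) * (n / (n - 1))).
  by field; rewrite !gt_eqF.
rewrite ler_wpM2l ?invr_ge0 ?(ltW n0)//.
apply: le_trans (_ : N%:R * t `^ (- n) * \sum_(1 <= k < K.+1) k%:R `^ (- n) <= _).
  rewrite mulr_sumr; apply: ler_sum => k _.
  rewrite powRM ?ler0n ?(ltW t0)// [X in _ * X]mulrC mulrA ler_wpM2r ?powR_ge0//.
  by rewrite ler_wpM2r ?powR_ge0// ler_nat leq_subr.
by rewrite ler_wpM2l ?mulr_ge0 ?powR_ge0// sum_powR_lt.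
Qed.

End SeqEnergy.

(** * Force balance *)

Section Counting.
Variable R : realType.

Lemma sum_indicator_nat (a b M : nat) : (a <= b)%N -> (b <= M)%N ->
  \sum_(0 <= i < M) ((a <= i < b)%N)%:R = (b - a)%N%:R :> R.
Proof.
move=> ab bM; transitivity (\sum_(a <= i < b) (1 : R)); last by rewrite sumr_const_nat.
rewrite [RHS](big_nat_widen _ _ M)//= [RHS](big_nat_widenl _ 0)//= [RHS]big_mkcond/=.
by apply: eq_bigr => i _; rewrite andbC; case: ifP.
Qed.

(** The window count, applied to the indicator of the gap l. *)
Lemma sum_straddle_le (N k l : nat) (c : R) : (0 < k)%N -> 0 <= c ->
  \sum_(0 <= i < N - k) (if (i <= l < i + k)%N then c else 0) <= k%:R * c.
Proof.
move=> k0 c0; have kR : (0 : R) < k%:R by rewrite ltr0n.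
have h := @sum_window_average_le R N k (fun l' => (l' == l)%:R) k0 (fun=> ler0n _ _).
have E (a b : nat) : \sum_(a <= l' < b) ((l' == l)%:R : R) = ((a <= l < b)%N)%:R.
  transitivity (\sum_(a <= l' < b | l' == l) (1 : R)).
    by rewrite [RHS]big_mkcond; apply: eq_bigr => l' _; case: eqP.
  by rewrite big_nat1_eq; case: ifP.
rewrite -mulr_sumr E in h; move: h.
under eq_bigr do rewrite E.
rewrite ler_pdivrMl// => h.
have -> : \sum_(0 <= i < N - k) (if (i <= l < i + k)%N then c else 0)
    = (\sum_(0 <= i < N - k) ((i <= l < i + k)%N)%:R) * c.
  by rewrite mulr_suml; apply: eq_bigr => i _; case: ifP; rewrite ?mul1r ?mul0r.
rewrite ler_wpM2r// (le_trans h)// -[leRHS]mulr1 ler_wpM2l ?ler0n//.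
by rewrite lern1 leq_b1.
Qed.

End Counting.

Section DeriveSum.
Variable R : realType.

Lemma is_derive_sum_seq (I : eqType) (r : seq I) (F : I -> R -> R) (dF : I -> R) (x : R) :
  {in r, forall i, is_derive x 1 (F i) (dF i)} ->
  is_derive x 1 (fun s => \sum_(i <- r) F i s) (\sum_(i <- r) dF i).
Proof.
elim: r => [_|a r IH Fr].
  rewrite big_nil (_ : (fun _ => _) = cst 0); first exact: is_derive_cst.
  by apply/funext => s; rewrite big_nil.
rewrite big_cons (_ : (fun _ => _) = F a \+ (fun s => \sum_(i <- r) F i s)); last first.
  by apply/funext => s; rewrite big_cons.
have Da : is_derive x 1 (F a) (dF a) by apply: Fr; rewrite mem_head.
have Dr := IH (fun i ir => Fr i (mem_behead (s := a :: r) ir)).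
exact: is_deriveD.
Qed.

Lemma is_derive_pair_sum N K (F : nat -> nat -> R -> R) (dF : nat -> nat -> R) (x : R) :
  (forall k i, (0 < k)%N -> is_derive x 1 (F k i) (dF k i)) ->
  is_derive x 1 (fun s => pair_sum N K (fun k i => F k i s)) (pair_sum N K dF).
Proof.
move=> FdF; apply: is_derive_sum_seq => k; rewrite mem_index_iota => /andP[k0 _].
by apply: is_derive_sum_seq => i _; exact: FdF.
Qed.

End DeriveSum.

Section Minimizer.
Variable R : realType.
Variables (m n : R) (N K : nat) (y : nat -> R).
Hypotheses (m1 : -1 < m) (mn : m < n) (n0 : 0 < n) (K0 : (0 < K)%N).
Hypothesis y_incr : {homo y : i j / (i < j)%N >-> i < j}.
Hypothesis y_min : forall z : nat -> R, {homo z : i j / (i < j)%N >-> i < j} ->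
  seq_energy m n N K y <= seq_energy m n N K z.

(** The derivative of the energy when all steps to the right of the gap l are
    moved rigidly to the right. *)
Definition gap_force (l : nat) : R :=
  pair_sum N K (fun k i => if (i <= l < i + k)%N then
    (y (i + k)%N - y i) `^ (- m - 1) - (y (i + k)%N - y i) `^ (- n - 1) else 0).

Lemma gap_force0 l : gap_force l = 0.
Proof.
pose z (s : R) (j : nat) := y j + (if (l < j)%N then s else 0).
pose g := y l.+1 - y l; have g0 : 0 < g by exact: gap_gt0.
have z_incr (s : R) : - g < s -> {homo z s : i j / (i < j)%N >-> i < j}.
  move=> gs i j ij; rewrite /z; case: (ltnP l i) => li.
    by rewrite (ltn_trans li ij) ltrD2r y_incr.
  case: (ltnP l j) => lj; last by rewrite !addr0 y_incr.
  have := increasing_le y_incr li; have := increasing_le y_incr lj.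
  by rewrite /g in gs; lra.
pose f s := seq_energy m n N K (z s).
have zE s k i : z s (i + k)%N - z s i
    = y (i + k)%N - y i + (if (i <= l < i + k)%N then s else 0).
  rewrite /z; case: (ltnP l i) => li /=.
    by rewrite ltn_addr//; ring.
  by case: ifP => _; ring.
have Df (s : R) : - g < s -> is_derive s 1 f (pair_sum N K (fun k i =>
    if (i <= l < i + k)%N then (z s (i + k)%N - z s i) `^ (- m - 1)
      - (z s (i + k)%N - z s i) `^ (- n - 1) else 0)).
  move=> gs; apply: is_derive_pair_sum => k i k0.
  have d0 : 0 < z s (i + k)%N - z s i by apply: distance_gt0 => //; exact: z_incr.
  rewrite (_ : (fun _ => _) = (fun t => pair_potential m n
      (y (i + k)%N - y i + (if (i <= l < i + k)%N then t else 0)))); last first.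
    by apply/funext => t; rewrite zE.
  move: d0; rewrite zE; case: ifP => _ d0; last exact: is_derive_cst.
  have Dv := is_derive_pair_potential m (lt0r_neq0 n0) d0.
  set c := y (i + k)%N - y i in d0 Dv *.
  have Dc : is_derive s 1 (fun t : R => c + t) 1.
    have Dx := is_deriveD (is_derive_cst c s 1) (is_derive_id s 1).
    by rewrite add0r in Dx.
  have := is_derive1_comp Dv Dc; rewrite /= mulr1; exact.
have D0 : is_derive (0 : R) 1 f 0.
  apply: (@derive1_at_min _ f (- g) g) => //.
  - lra.
  - by move=> t /[!in_itv]/= /andP[gt _]; have D := Df _ gt; exact: ex_derive.
  - by rewrite in_itv/=; lra.
  - move=> t /[!in_itv]/= /andP[gt _]; rewrite /f.
    have -> : z 0 = y by apply/funext => j; rewrite /z; case: ifP; rewrite addr0.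
    by apply: y_min; exact: z_incr.
have gN0 : - g < 0 by lra.
have D1 := Df 0 gN0.
have <- : 'D_1 f (0 : R) = 0 by exact: derive_val.
rewrite (@derive_val _ _ _ _ _ _ _ D1).
by apply: eq_pair_sum => k i _ _; rewrite zE; case: ifP => _; rewrite ?addr0.
Qed.

Lemma straddle_distance_ge k i l : (i <= l < i + k)%N ->
  y l.+1 - y l <= y (i + k)%N - y i.
Proof. by move=> /andP[il lik]; rewrite lerB// increasing_le. Qed.

(** Across a gap larger than 1 every pair attracts. *)
Lemma minimizer_gap_le1 l : (l.+1 < N)%N -> y l.+1 - y l <= 1.
Proof.
move=> lN; rewrite leNgt; apply/negP => g1.
have d1 k i : (i <= l < i + k)%N ->
    (y (i + k)%N - y i) `^ (- n - 1) < (y (i + k)%N - y i) `^ (- m - 1).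
  move=> /straddle_distance_ge h; have d1 := lt_le_trans g1 h.
  have d0 := lt_trans ltr01 d1.
  by rewrite !powR_expR// ltr_expR ltr_pM2r ?ln_gt0// ltrD2r ltrN2.
suff : 0 < gap_force l by rewrite gap_force0 ltxx.
pose F k i := if (i <= l < i + k)%N then
    (y (i + k)%N - y i) `^ (- m - 1) - (y (i + k)%N - y i) `^ (- n - 1) else 0.
apply: (@lt_le_trans _ _ (F 1%N l)).
  by rewrite /F addn1 leqnn ltnSn subr_gt0 -addn1 d1// addn1 leqnn ltnSn.
apply: pair_sum_ge_term; rewrite ?addn1// => k i _ _; rewrite /F.
by case: ifP => // /d1; rewrite subr_ge0; exact: ltW.
Qed.

(** At the smallest gap, the repulsion of its two ends is balanced by the
    attraction of the straddling pairs, at most k of which have index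
    distance k. *)
Lemma minimizer_smallest_gap l : (l.+1 < N)%N ->
  (forall l', (l'.+1 < N)%N -> y l.+1 - y l <= y l'.+1 - y l') ->
  (y l.+1 - y l) `^ (m - n) <= \sum_(1 <= k < K.+1) k%:R `^ (- m).
Proof.
move=> lN; set lam := y l.+1 - y l => lamP.
have lam0 : 0 < lam by exact: gap_gt0.
have bal : pair_sum N K (fun k i => if (i <= l < i + k)%N then
      (y (i + k)%N - y i) `^ (- n - 1) else 0)
    = pair_sum N K (fun k i => if (i <= l < i + k)%N then
      (y (i + k)%N - y i) `^ (- m - 1) else 0).
  apply/eqP; rewrite eq_sym -subr_eq0 -pair_sumN -pair_sumD -(gap_force0 l); apply/eqP.
  by apply: eq_pair_sum => k i _ _; case: ifP => _; rewrite ?subrr.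
have rep : lam `^ (- n - 1) <= pair_sum N K (fun k i => if (i <= l < i + k)%N then
      (y (i + k)%N - y i) `^ (- n - 1) else 0).
  pose F k i : R := if (i <= l < i + k)%N then (y (i + k)%N - y i) `^ (- n - 1) else 0.
  have <- : F 1%N l = lam `^ (- n - 1) by rewrite /F addn1 leqnn ltnSn.
  apply: pair_sum_ge_term; rewrite ?addn1// => k i _ _; rewrite /F.
  by case: ifP => // _; exact: powR_ge0.
have att : pair_sum N K (fun k i => if (i <= l < i + k)%N then
      (y (i + k)%N - y i) `^ (- m - 1) else 0)
    <= lam `^ (- m - 1) * \sum_(1 <= k < K.+1) k%:R `^ (- m).
  apply: (@le_trans _ _ (pair_sum N K (fun k i => if (i <= l < i + k)%N then
      (k%:R * lam) `^ (- m - 1) else 0))).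
    apply: le_pair_sum => k i /andP[k0 _] ikN; case: ifP => // _.
    rewrite -opprD le_powR_neg ?mulr_gt0 ?ltr0n//; first by move: m1; lra.
    exact: distance_ge lamP ikN.
  rewrite mulr_sumr /pair_sum; apply: ler_sum_nat => k /andP[k0 _].
  have kR : (0 : R) < k%:R by rewrite ltr0n.
  apply: le_trans (sum_straddle_le _ _ k0 (powR_ge0 _ _)) _.
  have -> : k%:R `^ (- m) = k%:R * k%:R `^ (- m - 1) :> R.
    rewrite -{2}[k%:R]powRr1 ?(ltW kR)// -powRDp//.
    by congr (_ `^ _); ring.
  by rewrite powRM ?(ltW kR) ?(ltW lam0)// mulrA mulrC.
have -> : m - n = (- n - 1) - (- m - 1) by ring.
rewrite powRDp// powRN ler_pdivrMr ?powR_gt0// mulrC.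
by rewrite (le_trans rep)// bal.
Qed.

(** * Crowding next to large gaps *)

(** Any radius greater than 1 would do: beyond it the net force of a pair is
    at least a fixed fraction of its attraction. *)
Definition neighbourhood_count (l : nat) : R :=
  \sum_(0 <= i < N) (`|y i - y l| < 2)%R%:R.

Lemma close_straddle_le l :
  pair_sum N K (fun k i => if (i <= l < i + k)%N && (y (i + k)%N - y i < 2) then 1 else 0)
  <= neighbourhood_count l ^+ 2.
Proof.
pose a i : R := (`|y i - y l| < 2)%R%:R.
have a0 i : 0 <= a i by exact: ler0n.
apply: (@le_trans _ _ (pair_sum N K (fun k i => a i * a (i + k)%N))).
  apply: le_pair_sum => k i _ _; case: ifP => [/andP[/andP[il lik] d2]|_]; last by rewrite mulr_ge0.
  have h1 := increasing_le y_incr il; have h2 := increasing_le y_incr (ltnW lik).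
  rewrite /a !ltr_norml.
  have -> : (- (2) < y i - y l < 2) = true by apply/andP; split; lra.
  have -> : (- (2) < y (i + k)%N - y l < 2) = true by apply/andP; split; lra.
  by rewrite mulr1.
rewrite (pair_sumE N K (fun i j => a i * a j)) expr2 {1}/neighbourhood_count mulr_suml.
apply: ler_sum => i _; rewrite mulr_sumr big_mkcond/=; apply: ler_sum => j _.
by case: ifP => // _; rewrite mulr_ge0.
Qed.

Lemma window_pairs l L : (L <= l.+1)%N -> (l.+1 + L <= N)%N -> (L.*2 <= K)%N ->
  pair_sum N K (fun k i => if [&& (l.+1 - L <= i)%N, (i <= l)%N, (l < i + k)%N
    & (i + k <= l + L)%N] then 1 else 0) = L%:R ^+ 2 :> R.
Proof.
move=> Ll lN LK.
rewrite (pair_sumE N K (fun i j => if [&& (l.+1 - L <= i)%N, (i <= l)%N, (l < j)%N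
    & (j <= l + L)%N] then 1 else 0)).
transitivity ((\sum_(0 <= i < N) ((l.+1 - L <= i < l.+1)%N)%:R)
    * (\sum_(0 <= j < N) ((l.+1 <= j < l.+1 + L)%N)%:R) : R); last first.
  rewrite !sum_indicator_nat ?leq_addr ?leq_subr//; last lia.
  by rewrite expr2 subKn// addKn.
rewrite mulr_suml; apply: eq_bigr => i _; rewrite mulr_sumr big_mkcond/=.
apply: eq_bigr => j _; rewrite -natrM mulnb.
case: ifP => c1; [case: ifP => c2|]; do ?[congr (_%:R)]; rewrite ?mulr1n.
- by rewrite (_ : _ && _ = true)//; lia.
- by rewrite (_ : _ && _ = false)//; lia.
- by rewrite (_ : _ && _ = false)//; lia.
Qed.

(** The L ^+ 2 pairs made of one of L steps on either side of the gap have
    length at most 2 L, because gaps are at most 1; those of length at least 2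
    have a net attraction of at least a multiple of (2 L) `^ (- m - 1). Only
    pairs closer than 2 can balance this, each with a repulsion of at most
    del `^ (- n - 1), so there must be many of them. *)
Lemma crowding l L (del : R) : (0 < L)%N -> (L <= l.+1)%N -> (l.+1 + L <= N)%N ->
  (L.*2 <= K)%N -> 0 < del <= 1 -> del <= y l.+1 - y l ->
  (1 - 2 `^ (m - n)) * 2 `^ (- m - 2) * (del `^ (n + 1) * L%:R `^ (1 - m))
    <= neighbourhood_count l ^+ 2.
Proof.
move=> L0 Ll lN LK /andP[del0 del1] delg.
have idx k i : (l.+1 - L <= i)%N -> (i + k <= l + L)%N -> (k <= 2 * L)%N by lia.
have [m1_ mn_ n0_] := And3 m1 mn n0.
have LR : (0 : R) < L%:R by rewrite ltr0n.
pose c0 := 1 - 2 `^ (m - n) : R.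
have c0P : 0 <= c0 <= 1.
  rewrite /c0 gerBl powR_ge0 andbT subr_ge0 powR_expR// -[leRHS]expR0 ler_expR.
  by rewrite mulr_le0_ge0 ?ln_ge0//; lra.
have /andP[c00 c01] := c0P.
pose q := c0 * (2 * L%:R) `^ (- m - 1).
have twoL1 : 1 <= 2 * L%:R :> R by rewrite -natrM ler1n muln_gt0.
have q0 : 0 <= q by rewrite mulr_ge0 ?powR_ge0.
have q1 : q <= 1.
  rewrite /q mulr_ile1 ?powR_ge0// -[leRHS](powRr0 (2 * L%:R)) ler_powR//; lra.
pose p := del `^ (- n - 1).
have p1 : 1 <= p.
  have := @le_powR_neg R (n + 1) del 1 _ del0 del1.
  by rewrite opprD powR1; apply; lra.
pose W k i : R := if [&& (l.+1 - L <= i)%N, (i <= l)%N, (l < i + k)%N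
    & (i + k <= l + L)%N] then 1 else 0.
pose B k i : R := if (i <= l < i + k)%N && (y (i + k)%N - y i < 2) then 1 else 0.
(* pair by pair, the force is at least q on the window pairs, minus p + q on
   the close pairs *)
have key : q * pair_sum N K W - (p + q) * pair_sum N K B <= 0.
  rewrite -(gap_force0 l) -!pair_sumZ -pair_sumN -pair_sumD.
  apply: le_pair_sum => k i /andP[k0 kK] ikN; rewrite /W /B.
  case: (boolP (i <= l < i + k)%N) => [str|nstr] /=; last first.
    case: ifP => [/and4P[_ il lik _]|_]; last by rewrite !mulr0 subrr.
    by rewrite il lik in nstr.
  have d0 := distance_gt0 y_incr i k0; have dg := straddle_distance_ge str.
  have dk : y (i + k)%N - y i <= k%:R.
    rewrite distance_sum_gap -[k in leRHS](addKn i) -[leRHS]mulr1 mulr_natl -sumr_const_nat.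
    apply: ler_sum_nat => l' /andP[_ h]; apply: minimizer_gap_le1.
    exact: leq_ltn_trans h ikN.
  set d := y (i + k)%N - y i in d0 dg dk *.
  have [d2|d2] := ltP d 2.
    have dp : d `^ (- n - 1) <= p.
      by rewrite /p -opprD le_powR_neg//; [lra|exact: le_trans dg].
    have dm := powR_ge0 d (- m - 1).
    by case: ifP => _; rewrite ?mulr1 ?mulr0; lra.
  have dmn : c0 * d `^ (- m - 1) <= d `^ (- m - 1) - d `^ (- n - 1).
    have -> : - n - 1 = (m - n) + (- m - 1) by ring.
    rewrite powRDp// -{2}[d `^ (- m - 1)]mul1r -mulrBl ler_wpM2r ?powR_ge0// lerD2l lerN2.
    by rewrite -opprB le_powR_neg ?subr_ge0 ?(ltW mn)//.
  rewrite mulr0 subr0; apply: le_trans dmn.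
  case: ifP => [/and4P[i1 i2 i3 i4]|_]; last by rewrite mulr0 mulr_ge0 ?powR_ge0.
  rewrite mulr1 ler_wpM2l// -opprD le_powR_neg//; first lra.
  by rewrite (le_trans dk)// -natrM ler_nat; exact: idx i1 i4.
apply: (@le_trans _ _ (pair_sum N K B)); last exact: close_straddle_le.
have p0 : 0 < p by exact: lt_le_trans p1.
rewrite window_pairs// subr_le0 in key.
have B0 : 0 <= pair_sum N K B by apply: pair_sum_ge0 => k i _ _; rewrite /B; case: ifP.
have h : q * L%:R ^+ 2 <= 2 * p * pair_sum N K B.
  by apply: le_trans key _; rewrite ler_wpM2r//; lra.
have pE : del `^ (n + 1) = p^-1 by rewrite /p -opprD powRN invrK.
rewrite pE.
have LE : 2 `^ (- m - 2) * L%:R `^ (1 - m) = 2^-1 * ((2 * L%:R) `^ (- m - 1) * L%:R ^+ 2) :> R.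
  rewrite powRM ?(ltW LR)// -powR_mulrn ?(ltW LR)//.
  have -> : L%:R `^ (1 - m) = L%:R `^ (- m - 1) * L%:R `^ 2%:R :> R.
    by rewrite -powRDp//; congr (_ `^ _); ring.
  have -> : 2 `^ (- m - 2) = 2 `^ (- m - 1) * 2^-1 :> R.
    by rewrite -powR_inv1// -powRDp//; congr (_ `^ _); ring.
  by ring.
rewrite (_ : _ * _ * _ = (2 * p)^-1 * (q * L%:R ^+ 2)); last first.
  rewrite /q -!mulrA -/c0 [_ * (p^-1 * _)]mulrCA LE; field.
  by rewrite gt_eqF.
by rewrite ler_pdivrMl// mulr_gt0.
Qed.

(** The gaps that start at distance less than 2 from x are disjoint intervals
    contained in [x - 2, x + 3]; clipping y to that interval telescopes. *)
Lemma sum_gap_near_le (x : R) (M : nat) : (M < N)%N ->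
  \sum_(0 <= l < M) (y l.+1 - y l) * (`|x - y l| < 2)%R%:R <= 5.
Proof.
move=> MN; pose c (t : R) := Num.max (x - 2) (Num.min t (x + 3)).
have cb t : x - 2 <= c t <= x + 3.
  by rewrite /c le_max lexx/= ge_max ge_min lexx orbT andbT; lra.
apply: (@le_trans _ _ (\sum_(0 <= l < M) (c (y l.+1) - c (y l)))); last first.
  rewrite telescope_sumr//.
  have /andP[_ h1] := cb (y M); have /andP[h2 _] := cb (y 0%N); lra.
apply: ler_sum_nat => l /andP[_ lM].
have g1 : y l.+1 - y l <= 1 by apply: minimizer_gap_le1; lia.
have g0 := gap_gt0 y_incr l.
case: (boolP (_ < 2)) => [|_]; last first.
  rewrite mulr0 subr_ge0 /c ge_max !le_max lexx/=.
  apply/orP; right; rewrite le_min !ge_min lexx orbT andbT (ltW _)//.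
  by rewrite -subr_gt0.
rewrite ltr_norml mulr1 => /andP[h1 h2].
have cE t : x - 2 <= t -> t <= x + 3 -> c t = t.
  by move=> t1 t2; rewrite /c (min_idPl t2) (max_idPr t1).
rewrite !cE//; lra.
Qed.

(** Gaps are of three kinds: within L of an end (at most 2 L of them, each at
    most 1), smaller than del, and crowded, with at least nu steps nearby. The
    total length of the last kind, times nu, is at most the sum of the gap
    lengths over all pairs of a gap and a step near it, hence at most 5 N. *)
Lemma minimizer_size_le (L : nat) (del nu : R) : (0 < L)%N -> (L.*2 <= K)%N ->
  (L.*2 <= N)%N -> 0 < del <= 1 -> 0 < nu ->
  nu ^+ 2 <= (1 - 2 `^ (m - n)) * 2 `^ (- m - 2) * (del `^ (n + 1) * L%:R `^ (1 - m)) ->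
  y (N - 1)%N - y 0%N <= 2 * L%:R + N%:R * del + 5 * N%:R / nu.
Proof.
move=> L0 LK LN delP nu0 nuP.
have cnt0 l : 0 <= neighbourhood_count l by apply: sumr_ge0 => i _; exact: ler0n.
have gap_le l : (l < N - 1)%N -> y l.+1 - y l
    <= (((0 <= l < L)%N)%:R + ((N - L <= l < N - 1)%N)%:R) + del
       + nu^-1 * ((y l.+1 - y l) * neighbourhood_count l).
  move=> lN; have g1 : y l.+1 - y l <= 1 by apply: minimizer_gap_le1; lia.
  have g0 := gap_gt0 y_incr l.
  have t0 : 0 <= nu^-1 * ((y l.+1 - y l) * neighbourhood_count l).
    by rewrite !mulr_ge0 ?invr_ge0 ?(ltW nu0)// ltW.
  have /andP[del0 _] := delP.
  have [lL|lL] := ltnP l L; first by rewrite (le_trans g1)//= -!addrA lerDl !addr_ge0 ?ler0n ?(ltW del0).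
  have [Ll|Ll] := leqP (N - L) l.
    by rewrite lN (le_trans g1)//= add0r -addrA lerDl addr_ge0 ?(ltW del0).
  have [dg|dg] := leP del (y l.+1 - y l); last first.
    by rewrite (le_trans (ltW dg))// -addrA addrCA lerDl addr_ge0 ?addr_ge0 ?ler0n.
  have cr : nu <= neighbourhood_count l.
    rewrite -(@ler_pXn2r _ 2) ?nnegrE ?(ltW nu0)//.
    by apply: le_trans nuP _; apply: crowding => //; lia.
  apply: (@le_trans _ _ (nu^-1 * ((y l.+1 - y l) * neighbourhood_count l))).
    by rewrite ler_pdivlMl// mulrC ler_wpM2l// ltW.
  by rewrite lerDr addr_ge0 ?(ltW del0)// addr_ge0 ?ler0n.
rewrite -(telescope_sumr y (leq0n _)).
apply: le_trans (ler_sum_nat (G := fun l => _) (fun l h => gap_le l (proj2 (andP h)))) _.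
have edge : \sum_(0 <= i < N - 1) ((i < L)%N)%:R = L%:R :> R.
  by have := @sum_indicator_nat R 0 L (N - 1); rewrite subn0; apply=> //; lia.
rewrite !big_split/= edge sum_indicator_nat//; last lia.
rewrite -mulr_sumr sumr_const_nat subn0.
apply: lerD; first apply: lerD.
- by rewrite -natrD -natrM ler_nat; lia.
- by rewrite -[leLHS]mulr_natl ler_wpM2r ?ler_nat ?leq_subr//; case/andP: delP => /ltW.
rewrite mulrC ler_wpM2r ?invr_ge0 ?(ltW nu0)//.
under eq_bigr do rewrite mulr_sumr.
rewrite exchange_big_nat/= -[leRHS]mulrC.
apply: (@le_trans _ _ (\sum_(0 <= i < N) (5 : R))).
  apply: ler_sum_nat => i /andP[_ iN]; apply: sum_gap_near_le; lia.
by rewrite sumr_const_nat subn0 mulr_natl.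
Qed.

End Minimizer.

(** * The uniform configuration *)

Section Uniform.
Variable R : realType.
Implicit Types (m : R) (N K : nat).

(** The attractive energy at unit gap, up to the factor - m^-1. *)
Definition weighted_power_sum N K m : R :=
  \sum_(1 <= k < K.+1) (N - k)%:R * k%:R `^ (- m).

Lemma weighted_power_sum_le N K m : m < 1 ->
  weighted_power_sum N K m <= (Num.min 1 (1 - m))^-1 * (N%:R * K%:R `^ (1 - m)).
Proof.
move=> m1; rewrite mulrCA; apply: le_trans (_ : N%:R * \sum_(1 <= k < K.+1) k%:R `^ (- m) <= _).
  rewrite mulr_sumr; apply: ler_sum => k _.
  by rewrite ler_wpM2r ?powR_ge0// ler_nat leq_subr.
by rewrite ler_wpM2l// sum_powR_le.
Qed.

Lemma sum_nat_mul_sub N K : (K <= N)%N ->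
  \sum_(1 <= k < K.+1) (N - k)%:R * k%:R
    = N%:R * K%:R * (K%:R + 1) / 2 - K%:R * (K%:R + 1) * (2 * K%:R + 1) / 6 :> R.
Proof.
elim: K => [|K IH] KN; first by rewrite big_geq//; field.
rewrite big_nat_recr//= IH ?(ltnW KN)// natrB// -!natr1; by field.
Qed.

(** For k <= K the power k `^ (- m) is at least K `^ (- m) * (k / K), since
    - m <= 1; this reduces to a sum of squares. *)
Lemma weighted_power_sum_ge N K m : -1 < m -> (1 < N)%N -> (0 < K <= N)%N ->
  12^-1 * (N%:R * K%:R `^ (1 - m)) <= weighted_power_sum N K m.
Proof.
move=> m1 N1 /andP[K0 KN]; have KR : (0 : R) < K%:R by rewrite ltr0n.
have K1 : (1 : R) <= K%:R by rewrite ler1n.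
have N2 : (2 : R) <= N%:R by rewrite ler_nat.
have KNR : (K%:R : R) <= N%:R by rewrite ler_nat.
apply: (@le_trans _ _ (K%:R `^ (- m - 1) * \sum_(1 <= k < K.+1) (N - k)%:R * k%:R)).
  rewrite sum_nat_mul_sub//.
  have -> : K%:R `^ (1 - m) = K%:R `^ (- m - 1) * K%:R ^+ 2 :> R.
    by rewrite -powR_mulrn ?(ltW KR)// -powRDp//; congr (_ `^ _); ring.
  rewrite !mulrA [_ * _ `^ _]mulrC -!mulrA ler_wpM2l ?powR_ge0//; nra.
rewrite mulr_sumr; apply: ler_sum_nat => k /andP[k0 kK].
have kR : (0 : R) < k%:R by rewrite ltr0n.
rewrite mulrCA ler_wpM2l//.
have -> : k%:R `^ (- m) = k%:R * k%:R `^ (- (m + 1)) :> R.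
  rewrite -{2}[k%:R]powRr1 ?(ltW kR)// -powRDp//; congr (_ `^ _); ring.
by rewrite mulrC ler_wpM2l ?(ltW kR)// -opprD le_powR_neg ?ler_nat//; lra.
Qed.

Lemma uniform_attractionE m N K (t : R) : m != 0 -> 0 < t ->
  uniform_attraction m N K t = - (m^-1 * (t `^ (- m) * weighted_power_sum N K m)).
Proof.
move=> m0 t0; rewrite /uniform_attraction /weighted_power_sum !mulr_sumr -sumrN.
apply: eq_bigr => k _; rewrite /attraction (negPf m0) powRM ?ler0n ?(ltW t0)//; ring.
Qed.

Definition pair_count N K : R := \sum_(1 <= k < K.+1) (N - k)%:R.

Lemma pair_count_ge N K : (1 < N)%N -> (0 < K <= N)%N ->
  12^-1 * (N%:R * K%:R) <= pair_count N K.
Proof.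
move=> N1 K0; have := @weighted_power_sum_ge N K 0 (ltrN10 _) N1 K0.
rewrite subr0 powRr1// /weighted_power_sum => /le_trans; apply.
by rewrite le_eqVlt; apply/orP; left; apply/eqP/eq_bigr => k _; rewrite oppr0 powRr0 mulr1.
Qed.

Lemma pair_countE N K : (K <= N)%N -> pair_count N K = N%:R * K%:R - K%:R * (K%:R + 1) / 2.
Proof.
rewrite /pair_count; elim: K => [|K IH] KN; first by rewrite big_geq//; field.
rewrite big_nat_recr//= IH ?(ltnW KN)// natrB// -!natr1; by field.
Qed.

(** A weak form of Stirling's lower bound on the factorial. *)
Lemma sum_ln_ge K : (0 < K)%N ->
  K%:R * ln K%:R - K%:R <= \sum_(1 <= k < K.+1) ln k%:R :> R.
Proof.
elim: K => // -[_ _|K IH _]; first by rewrite big_nat1 ln1; lra.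
rewrite big_nat_recr//= -lerBlDr; apply: le_trans (IH isT).
set a : R := K.+1%:R; have a0 : 0 < a by rewrite ltr0n.
have -> : K.+2%:R = a * (1 + a^-1) :> R by rewrite mulrDr mulr1 divff ?gt_eqF// /a natr1.
have ai0 : 0 < a^-1 by rewrite invr_gt0.
rewrite lnM ?posrE ?addr_gt0//.
have h : a * ln (1 + a^-1) <= 1.
  by rewrite mulrC -ler_pdivlMr// mul1r le_ln1Dx// (lt_trans (ltrN10 _)).
have -> : a * (1 + a^-1) = a + 1 by rewrite mulrDr mulr1 divff ?gt_eqF.
lra.
Qed.

Lemma weighted_ln_sum_bounds N K : (0 < K)%N ->
  pair_count N K * ln K%:R - N%:R * K%:R
    <= \sum_(1 <= k < K.+1) (N - k)%:R * ln k%:R <= pair_count N K * ln K%:R.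
Proof.
move=> K0; have KR : (0 : R) < K%:R by rewrite ltr0n.
have lnle k : (0 < k < K.+1)%N -> ln k%:R <= ln K%:R :> R.
  by move=> /andP[k0 kK]; rewrite ler_ln ?posrE ?ltr0n// ler_nat.
rewrite /pair_count mulr_suml; apply/andP; split; last first.
  by apply: ler_sum_nat => k kK; rewrite ler_wpM2l// lnle.
rewrite lerBlDr -lerBlDl -sumrB.
apply: (@le_trans _ _ (N%:R * \sum_(1 <= k < K.+1) (ln K%:R - ln k%:R))).
  rewrite mulr_sumr; apply: ler_sum_nat => k kK; rewrite -mulrBr.
  by rewrite ler_wpM2r ?subr_ge0 ?lnle// ler_nat leq_subr.
rewrite ler_wpM2l// sumrB sumr_const_nat subSS subn0 -[ln _ *+ _]mulr_natl.
by have := sum_ln_ge K0; lra.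
Qed.

Lemma uniform_attraction_ln N K (t : R) : 0 < t ->
  uniform_attraction 0 N K t
    = pair_count N K * ln t + \sum_(1 <= k < K.+1) (N - k)%:R * ln k%:R.
Proof.
move=> t0; rewrite /uniform_attraction /pair_count mulr_suml -big_split/=.
apply: eq_big_nat => k /andP[k0 _]; rewrite /attraction eqxx lnM ?posrE ?ltr0n//; ring.
Qed.

End Uniform.

(** * Energy in terms of the interaction range *)

Section Scaling.
Variable R : realType.
Implicit Types (m n : R) (N K : nat) (y : nat -> R).

Definition seq_minimizer m n N K y : Prop :=
  {homo y : i j / (i < j)%N >-> i < j} /\
  forall z : nat -> R, {homo z : i j / (i < j)%N >-> i < j} ->
    seq_energy m n N K y <= seq_energy m n N K z.

Lemma minimizer_le_uniform m n N K y (t : R) : m < n -> 1 < n -> 0 < t ->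
  seq_minimizer m n N K y -> seq_energy m n N K y
    <= uniform_attraction m N K t + (n - 1)^-1 * (N%:R * t `^ (- n)).
Proof.
move=> mn n1 t0 [_ ymin]; apply: le_trans (seq_energy_uniform_le m N K _ n1 t0).
  by apply: ymin => i j ij; rewrite ltr_pM2r// ltr_nat.
exact: lt_trans ltr01 n1.
Qed.

Lemma min1B_gt0 m : m < 1 -> 0 < Num.min 1 (1 - m).
Proof. by move=> m1; rewrite lt_min ltr01 subr_gt0. Qed.

(** Balancing K `^ (1 - m) * t `^ (- m) against t `^ (- n) gives the gap
    K `^ (- gam) with gam := (1 - m) / (n - m). *)
Lemma seq_energy_ge m n N K y : -1 < m -> m < 1 -> 1 < n -> (0 < K)%N ->
  {homo y : i j / (i < j)%N >-> i < j} ->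
  uniform_attraction m N K
    (Num.min 1 (1 - m) `^ (n - m)^-1 * K%:R `^ (- ((1 - m) / (n - m))))
  <= seq_energy m n N K y.
Proof.
move=> m1 m2 n1 K0 yi; have a0 := min1B_gt0 m2; set a := Num.min 1 (1 - m) in a0 *.
have KR : (0 : R) < K%:R by rewrite ltr0n.
have nm : 0 < n - m by lra.
apply: seq_energy_ge_uniform => //; [lra|lra|by rewrite mulr_gt0 ?powR_gt0|].
rewrite powRM ?powR_ge0// -!powRrM mulVf ?gt_eqF// powRr1 ?(ltW a0)//.
rewrite mulNr divfK ?gt_eqF// powRN.
have P0 : 0 < K%:R `^ (1 - m) :> R by rewrite powR_gt0.
have := @sum_powR_le R m K m2; rewrite -/a; set S := \sum_(_ <= _ < _) _ => h.
rewrite -mulrA mulrCA ler_pdivrMl// mulr1.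
by rewrite -ler_pdivlMl.
Qed.

Lemma powR_gap_exponent m n K : m < n -> (0 < K)%N ->
  (K%:R `^ (- ((1 - m) / (n - m)))) `^ (- m) * K%:R `^ (1 - m)
    = K%:R `^ ((1 - m) * n / (n - m)) :> R.
Proof.
move=> mn K0; have KR : (0 : R) < K%:R by rewrite ltr0n.
rewrite -powRrM -powRDp//; congr (_ `^ _).
by field; rewrite gt_eqF// subr_gt0.
Qed.

Lemma powR_gap_repulsion m n K : m < n -> (0 < K)%N ->
  (K%:R `^ (- ((1 - m) / (n - m)))) `^ (- n) = K%:R `^ ((1 - m) * n / (n - m)) :> R.
Proof.
move=> mn K0; rewrite -powRrM; congr (_ `^ _).
by field; rewrite gt_eqF// subr_gt0.
Qed.

Lemma energy_ge_of_neg m n : -1 < m -> m < 0 -> 1 < n ->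
  exists2 c : R, 0 < c & forall N K y, (1 < N)%N -> (0 < K <= N)%N ->
    {homo y : i j / (i < j)%N >-> i < j} ->
    c * (N%:R * K%:R `^ ((1 - m) * n / (n - m))) <= seq_energy m n N K y.
Proof.
move=> m1 m0 n1; have a0 : 0 < Num.min 1 (1 - m) by apply: min1B_gt0; lra.
pose c1 : R := Num.min 1 (1 - m) `^ (n - m)^-1; have c10 : 0 < c1 by rewrite powR_gt0.
exists (- m^-1 * c1 `^ (- m) / 12).
  by rewrite divr_gt0// mulr_gt0 ?powR_gt0// oppr_gt0 invr_lt0.
move=> N K y N1 KN yi; have /andP[K0 _] := KN.
have m2 : m < 1 by lra.
apply: le_trans (seq_energy_ge N m1 m2 n1 K0 yi).
have KR : (0 : R) < K%:R by rewrite ltr0n.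
rewrite uniform_attractionE ?lt_eqF ?mulr_gt0 ?powR_gt0// powRM ?powR_ge0//.
rewrite -/c1 -mulNr -(@powR_gap_exponent m n K)//; last lra.
have := @weighted_power_sum_ge R N K m m1 N1 KN.
set S := weighted_power_sum _ _ _; set P := (_ `^ _) `^ _; set Q := _ `^ (1 - m).
move=> h; have P0 : 0 <= P by exact: powR_ge0.
have -> : - m^-1 * c1 `^ (- m) / 12 * (N%:R * (P * Q))
   = - m^-1 * (c1 `^ (- m) * P * (12^-1 * (N%:R * Q))) by ring.
by rewrite ler_wpM2l ?oppr_ge0 ?invr_le0 ?(ltW m0)// ler_wpM2l ?mulr_ge0 ?powR_ge0.
Qed.

Lemma energy_ge_of_pos m n : 0 < m -> m < 1 -> 1 < n ->
  exists2 c : R, 0 < c & forall N K y, (1 < N)%N -> (0 < K <= N)%N ->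
    {homo y : i j / (i < j)%N >-> i < j} ->
    - c * (N%:R * K%:R `^ ((1 - m) * n / (n - m))) <= seq_energy m n N K y.
Proof.
move=> m0 m2 n1; have a0 : 0 < Num.min 1 (1 - m) by apply: min1B_gt0; lra.
pose c1 : R := Num.min 1 (1 - m) `^ (n - m)^-1; have c10 : 0 < c1 by rewrite powR_gt0.
exists (m^-1 * c1 `^ (- m) / Num.min 1 (1 - m)).
  by rewrite divr_gt0// mulr_gt0 ?powR_gt0// invr_gt0.
move=> N K y N1 KN yi; have /andP[K0 _] := KN.
have m1 : -1 < m by lra.
apply: le_trans (seq_energy_ge N m1 m2 n1 K0 yi).
have KR : (0 : R) < K%:R by rewrite ltr0n.
rewrite uniform_attractionE ?gt_eqF ?mulr_gt0 ?powR_gt0// powRM ?powR_ge0//.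
rewrite -/c1 mulNr lerN2 -(@powR_gap_exponent m n K)//; last lra.
have := @weighted_power_sum_le R N K m m2.
set S := weighted_power_sum _ _ _; set P := (_ `^ _) `^ _; set Q := _ `^ (1 - m).
move=> h; have P0 : 0 <= P by exact: powR_ge0.
have -> : m^-1 * c1 `^ (- m) / Num.min 1 (1 - m) * (N%:R * (P * Q))
   = m^-1 * (c1 `^ (- m) * P * ((Num.min 1 (1 - m))^-1 * (N%:R * Q))) by ring.
by rewrite ler_wpM2l ?invr_ge0 ?(ltW m0)// ler_wpM2l ?mulr_ge0 ?powR_ge0.
Qed.

Lemma min_energy_le_of_neg m n : -1 < m -> m < 0 -> 1 < n ->
  exists2 c : R, 0 < c & forall N K y, (1 < N)%N -> (0 < K <= N)%N ->
    seq_minimizer m n N K y ->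
    seq_energy m n N K y <= c * (N%:R * K%:R `^ ((1 - m) * n / (n - m))).
Proof.
move=> m1 m0 n1; have a0 : 0 < Num.min 1 (1 - m) by apply: min1B_gt0; lra.
exists (- m^-1 / Num.min 1 (1 - m) + (n - 1)^-1).
  by rewrite addr_gt0 ?divr_gt0 ?invr_gt0 ?subr_gt0// oppr_gt0 invr_lt0.
move=> N K y N1 KN ymin; have /andP[K0 _] := KN.
have KR : (0 : R) < K%:R by rewrite ltr0n.
have mn : m < n by lra.
have t0 : 0 < K%:R `^ (- ((1 - m) / (n - m))) :> R by rewrite powR_gt0.
apply: le_trans (minimizer_le_uniform mn n1 t0 ymin) _.
rewrite [leRHS]mulrDl (@powR_gap_repulsion m n K)// lerD2r.
rewrite uniform_attractionE ?lt_eqF// -[leLHS]mulNr -(@powR_gap_exponent m n K)//.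
have m2 : m < 1 by lra.
have := @weighted_power_sum_le R N K m m2.
set S := weighted_power_sum _ _ _; set P := (_ `^ _) `^ _; set Q := _ `^ (1 - m).
move=> h; have P0 : 0 <= P by exact: powR_ge0.
have -> : - m^-1 / Num.min 1 (1 - m) * (N%:R * (P * Q))
   = - m^-1 * (P * ((Num.min 1 (1 - m))^-1 * (N%:R * Q))) by ring.
by rewrite ler_wpM2l ?oppr_ge0 ?invr_le0 ?(ltW m0)// ler_wpM2l ?powR_ge0.
Qed.

(** With gap s * K `^ (- gam), both energies are of the same order, and the
    repulsion is half of the bound for the attraction when
    s `^ (m - n) = (n - 1) / (24 m). *)
Lemma min_energy_le_of_pos m n : 0 < m -> m < 1 -> 1 < n ->
  exists2 c : R, 0 < c & forall N K y, (1 < N)%N -> (0 < K <= N)%N ->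
    seq_minimizer m n N K y ->
    seq_energy m n N K y <= - c * (N%:R * K%:R `^ ((1 - m) * n / (n - m))).
Proof.
move=> m0 m2 n1; have n10 : 0 < n - 1 by lra.
have mn : m < n by lra.
pose u : R := (n - 1) / (24 * m); have u0 : 0 < u by rewrite divr_gt0// mulr_gt0.
pose s : R := u `^ (m - n)^-1; have s0 : 0 < s by rewrite powR_gt0.
exists (s `^ (- m) / (24 * m)); first by rewrite divr_gt0 ?powR_gt0// mulr_gt0.
move=> N K y N1 KN ymin; have /andP[K0 _] := KN.
have KR : (0 : R) < K%:R by rewrite ltr0n.
have t0 : 0 < s * K%:R `^ (- ((1 - m) / (n - m))) :> R by rewrite mulr_gt0 ?powR_gt0.
apply: le_trans (minimizer_le_uniform mn n1 t0 ymin) _.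
rewrite uniform_attractionE ?gt_eqF// !powRM ?powR_ge0 ?(ltW s0)//.
rewrite (@powR_gap_repulsion m n K)//.
have sn : s `^ (- n) = s `^ (- m) * u.
  rewrite (_ : - n = - m + (m - n)); last by ring.
  rewrite powRDp// /s -!powRrM mulVf ?powRr1 ?(ltW u0)//.
  by rewrite subr_eq0 lt_eqF.
have m1 : -1 < m by lra.
have h := @weighted_power_sum_ge R N K m m1 N1 KN.
have E := @powR_gap_exponent m n K mn K0.
set S := weighted_power_sum _ _ _ in h *; set P := (_ `^ _) `^ _ in E *.
set T := _ `^ (_ / _) in E *; set Q := _ `^ (1 - m) in E h.
have P0 : 0 <= P by exact: powR_ge0.
have A : m^-1 * (s `^ (- m) * (12^-1 * (N%:R * T))) <= m^-1 * (s `^ (- m) * P * S).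
  rewrite ler_wpM2l ?invr_ge0 ?(ltW m0)// -mulrA ler_wpM2l ?powR_ge0// -E.
  by rewrite (_ : 12^-1 * _ = P * (12^-1 * (N%:R * Q))) ?ler_wpM2l//; ring.
rewrite sn.
have -> : (n - 1)^-1 * (N%:R * (s `^ (- m) * u * T))
    = 2^-1 * (m^-1 * (s `^ (- m) * (12^-1 * (N%:R * T)))).
  by rewrite /u; field; rewrite !gt_eqF.
have -> : - (s `^ (- m) / (24 * m)) * (N%:R * T)
    = - (2^-1 * (m^-1 * (s `^ (- m) * (12^-1 * (N%:R * T))))).
  by field; rewrite !gt_eqF.
lra.
Qed.

Lemma min_energy_bounds_ln n : 1 < n -> forall N K y, (1 < N)%N -> (0 < K <= N)%N ->
  seq_minimizer 0 n N K y ->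
  (1 - n^-1) * (pair_count R N K * ln K%:R) - N%:R * K%:R <= seq_energy 0 n N K y
    <= (1 - n^-1) * (pair_count R N K * ln K%:R) + (n - 1)^-1 * (N%:R * K%:R).
Proof.
move=> n1 N K y N1 KN ymin; have /andP[K0 _] := KN.
have KR : (0 : R) < K%:R by rewrite ltr0n.
have n0 : 0 < n by lra.
have /andP[W1 W2] := @weighted_ln_sum_bounds R N K K0.
have t0 : 0 < K%:R `^ (- n^-1) :> R by rewrite powR_gt0.
have E : (K%:R : R) `^ (- n^-1) `^ (- n) = K%:R.
  by rewrite -powRrM mulrNN mulVf ?powRr1 ?(ltW KR)// gt_eqF.
apply/andP; split.
  have h := @seq_energy_ge 0 n N K y (ltrN10 _) ltr01 n1 K0 (proj1 ymin).
  apply: le_trans h.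
  rewrite !subr0 minxx powR1 mul1r div1r uniform_attraction_ln// ln_powR; lra.
apply: le_trans (minimizer_le_uniform n0 n1 t0 ymin) _.
rewrite uniform_attraction_ln// ln_powR E; lra.
Qed.

(** * The smallest gap *)

Lemma smallest_gap_ge m n N K y l : -1 < m -> m < 1 -> 1 < n -> (0 < K)%N ->
  seq_minimizer m n N K y -> (l.+1 < N)%N ->
  (forall l', (l'.+1 < N)%N -> y l.+1 - y l <= y l'.+1 - y l') ->
  Num.min 1 (1 - m) `^ (n - m)^-1 * K%:R `^ (- ((1 - m) / (n - m))) <= y l.+1 - y l.
Proof.
move=> m1 m2 n1 K0 [yi ymin] lN lmin; have a0 := min1B_gt0 m2.
have KR : (0 : R) < K%:R by rewrite ltr0n.
have mn : m < n by lra. have n0 : 0 < n by lra.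
have nm : 0 < n - m by lra.
have g0 := gap_gt0 yi l; set g := y l.+1 - y l in g0 lmin *.
have := minimizer_smallest_gap m1 n0 K0 yi ymin lN lmin; rewrite -/g.
move=> /le_trans/(_ (sum_powR_le K m2)); set a := Num.min 1 _ in a0 *.
rewrite -opprB => h.
have -> : g = (g `^ (- (n - m))) `^ (- (n - m)^-1).
  by rewrite -powRrM mulrNN divff ?gt_eqF// powRr1 ?(ltW g0).
have h2 : 0 <= (n - m)^-1 by rewrite invr_ge0 ltW.
apply: le_trans (le_powR_neg h2 (powR_gt0 _ g0) h).
rewrite powRM ?invr_ge0 ?powR_ge0 ?(ltW a0)//.
rewrite -[a^-1]powR_inv1 ?(ltW a0)// -!powRrM mulrNN mul1r.
by rewrite mulrN.
Qed.

Lemma smallest_gap_le_of_neg m n : -1 < m -> m < 0 -> 1 < n ->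
  exists2 c : R, 0 < c & forall N K y lam, (1 < N)%N -> (0 < K <= N)%N ->
    seq_minimizer m n N K y -> 0 < lam ->
    (forall l, (l.+1 < N)%N -> lam <= y l.+1 - y l) ->
    lam <= c * K%:R `^ (- ((1 - m) / (n - m))).
Proof.
move=> m1 m0 n1; have [C C0 CP] := min_energy_le_of_neg m1 m0 n1.
have q0 : 0 < 12 * - m * C by rewrite !mulr_gt0// oppr_gt0.
exists ((12 * - m * C) `^ (- m)^-1); first by rewrite powR_gt0.
move=> N K y lam N1 KN ymin lam0 lamP; have /andP[K0 _] := KN.
have KR : (0 : R) < K%:R by rewrite ltr0n.
have NR : (0 : R) < N%:R by rewrite ltr0n; lia.
have mn : m < n by lra. have n0 : 0 < n by lra.
have := le_trans (seq_energy_ge_uniform_of_gaps m K n0 (proj1 ymin) lam0 lamP) (CP N K y N1 KN ymin).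
rewrite uniform_attractionE ?lt_eqF// -(@powR_gap_exponent m n K)//.
have h := @weighted_power_sum_ge R N K m m1 N1 KN.
set S := weighted_power_sum _ _ _ in h *; set Q := _ `^ (1 - m) in h *.
have Q0 : 0 < Q by rewrite powR_gt0.
set P := (_ `^ _) `^ _ => h2.
have mi : 0 < - m^-1 by rewrite oppr_gt0 invr_lt0.
have h3 : lam `^ (- m) <= 12 * - m * C * P.
  have h4 : - m^-1 * (lam `^ (- m) * (12^-1 * (N%:R * Q))) <= C * (N%:R * (P * Q)).
    apply: le_trans h2; rewrite -mulNr ler_wpM2l ?(ltW mi)//.
    by rewrite ler_wpM2l ?powR_ge0.
  have p0 : 0 < - m^-1 * 12^-1 * (N%:R * Q) by rewrite !mulr_gt0.
  rewrite -(ler_pM2r p0).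
  rewrite [leLHS](_ : _ = - m^-1 * (lam `^ (- m) * (12^-1 * (N%:R * Q)))); last by ring.
  by rewrite (le_trans h4)// le_eqVlt; apply/orP; left; apply/eqP; field; rewrite lt_eqF.
have mN : 0 < - m by lra.
have -> : lam = (lam `^ (- m)) `^ (- m)^-1.
  by rewrite -powRrM divff ?gt_eqF// powRr1 ?(ltW lam0).
have -> : K%:R `^ (- ((1 - m) / (n - m))) = P `^ (- m)^-1 :> R.
  by rewrite /P -powRrM divff ?gt_eqF// powRr1 ?powR_ge0.
rewrite -powRM ?(ltW q0) ?powR_ge0// le_powR_pos ?powR_ge0//.
by rewrite invr_ge0 ltW.
Qed.

Lemma smallest_gap_le_of_pos m n : 0 < m -> m < 1 -> 1 < n ->
  exists2 c : R, 0 < c & forall N K y lam, (1 < N)%N -> (0 < K <= N)%N ->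
    seq_minimizer m n N K y -> 0 < lam ->
    (forall l, (l.+1 < N)%N -> lam <= y l.+1 - y l) ->
    lam <= c * K%:R `^ (- ((1 - m) / (n - m))).
Proof.
move=> m0 m2 n1; have [C C0 CP] := min_energy_le_of_pos m0 m2 n1.
have a0 := min1B_gt0 m2; set a := Num.min 1 (1 - m) in a0.
have q0 : 0 < m * a * C by rewrite !mulr_gt0.
exists ((m * a * C) `^ (- m^-1)); first by rewrite powR_gt0.
move=> N K y lam N1 KN ymin lam0 lamP; have /andP[K0 _] := KN.
have KR : (0 : R) < K%:R by rewrite ltr0n.
have NR : (0 : R) < N%:R by rewrite ltr0n; lia.
have mn : m < n by lra. have n0 : 0 < n by lra.
have := le_trans (seq_energy_ge_uniform_of_gaps m K n0 (proj1 ymin) lam0 lamP) (CP N K y N1 KN ymin).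
rewrite uniform_attractionE ?gt_eqF// -(@powR_gap_exponent m n K)// mulNr lerN2.
have h := @weighted_power_sum_le R N K m m2; rewrite -/a in h.
set S := weighted_power_sum _ _ _ in h *; set Q := _ `^ (1 - m) in h *.
have Q0 : 0 < Q by rewrite powR_gt0.
set P := (_ `^ _) `^ _ => h2.
have P0 : 0 < P by rewrite !powR_gt0.
have mi : 0 < m^-1 by rewrite invr_gt0.
have h3 : m * a * C * P <= lam `^ (- m).
  have h4 : C * (N%:R * (P * Q)) <= m^-1 * (lam `^ (- m) * (a^-1 * (N%:R * Q))).
    apply: le_trans h2 _; rewrite ler_wpM2l ?(ltW mi)//.
    by rewrite ler_wpM2l ?powR_ge0.
  have p0 : 0 < m^-1 * a^-1 * (N%:R * Q) by rewrite !mulr_gt0// invr_gt0.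
  rewrite -(ler_pM2r p0).
  rewrite [leRHS](_ : _ = m^-1 * (lam `^ (- m) * (a^-1 * (N%:R * Q)))); last by ring.
  by apply: le_trans h4; rewrite le_eqVlt; apply/orP; left; apply/eqP; field; rewrite !gt_eqF.
have -> : lam = (lam `^ (- m)) `^ (- m^-1).
  by rewrite -powRrM mulrNN divff ?gt_eqF// powRr1 ?(ltW lam0).
have -> : K%:R `^ (- ((1 - m) / (n - m))) = P `^ (- m^-1) :> R.
  by rewrite /P -powRrM mulrNN divff ?gt_eqF// powRr1 ?powR_ge0.
rewrite -powRM ?(ltW q0) ?(ltW P0)// le_powR_neg ?(ltW mi)//.
by rewrite mulr_gt0.
Qed.

Lemma smallest_gap_le_ln n : 1 < n ->
  forall N K y lam, (1 < N)%N -> (0 < K <= N)%N ->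
    seq_minimizer 0 n N K y -> 0 < lam ->
    (forall l, (l.+1 < N)%N -> lam <= y l.+1 - y l) ->
    lam <= expR (12 * (1 + (n - 1)^-1)) * K%:R `^ (- n^-1).
Proof.
move=> n1 N K y lam N1 KN ymin lam0 lamP; have /andP[K0 _] := KN.
have KR : (0 : R) < K%:R by rewrite ltr0n.
have NR : (0 : R) < N%:R by rewrite ltr0n; lia.
have n0 : 0 < n by lra.
have /andP[_ U] := min_energy_bounds_ln n1 N1 KN ymin.
have := le_trans (seq_energy_ge_uniform_of_gaps 0 K n0 (proj1 ymin) lam0 lamP) U.
have /andP[W1 _] := @weighted_ln_sum_bounds R N K K0.
rewrite uniform_attraction_ln// => h.
have Mge := @pair_count_ge R N K N1 KN.
set M := pair_count R N K in W1 h Mge U.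
rewrite -ler_pdivrMr ?powR_gt0// -powRN opprK.
rewrite -[leLHS]lnK ?posrE ?mulr_gt0 ?powR_gt0// ler_expR.
rewrite lnM ?posrE ?powR_gt0// ln_powR.
set w := ln lam + _.
have h1 : M * w <= (1 + (n - 1)^-1) * (N%:R * K%:R) by rewrite /w; lra.
have n10 : 0 <= (n - 1)^-1 by rewrite invr_ge0; lra.
have [w0|w0] := leP w 0; first by apply: le_trans w0 _; rewrite mulr_ge0//; lra.
have NK : 0 < N%:R * K%:R :> R by rewrite mulr_gt0.
have h2 : 12^-1 * (N%:R * K%:R) * w <= (1 + (n - 1)^-1) * (N%:R * K%:R).
  by apply: le_trans h1; rewrite ler_wpM2r// ltW.
rewrite -(ler_pM2l NK); lra.
Qed.

End Scaling.

(** * From configurations to increasing sequences *)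

Section Transfer.
Variable R : realType.
Implicit Types (m n alpha : R) (N K : nat).

Definition interaction_range alpha N : nat := Num.trunc (N%:R `^ alpha).

Lemma energy_seqE m n alpha N (z : nat -> R) :
  energy m n alpha (fun i : 'I_N => z i)
    = seq_energy m n N (interaction_range alpha N) z.
Proof.
rewrite /energy /seq_energy (pair_sumE _ _ (fun i j => pair_potential m n (z j - z i))).
rewrite big_mkord; apply: eq_bigr => i _; rewrite big_mkord.
apply: eq_bigl => j; congr (_ && _).
by rewrite floor_ge_int truncn_ge_nat ?powR_ge0// pmulrn.
Qed.

(** Steps beyond the last one are placed at unit distances, so that the
    sequence is increasing without restriction on the index. *)
Definition extend_config N (X : 'I_N.+1 -> R) (k : nat) : R :=
  X (inord (minn k N)) + (k - N)%N%:R.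

Lemma extend_config_val N (X : 'I_N.+1 -> R) (i : 'I_N.+1) : extend_config X i = X i.
Proof.
have iN : (i <= N)%N by rewrite -ltnS.
by rewrite /extend_config (minn_idPl iN) inord_val (eqP iN) addr0.
Qed.

Lemma extend_config_incr N (X : 'I_N.+1 -> R) : step_config X ->
  {homo extend_config X : i j / (i < j)%N >-> i < j}.
Proof.
move=> sX i j ij; rewrite /extend_config.
have [jN|Nj] := leqP j N.
  have iN : (i < N)%N by exact: leq_trans jN.
  rewrite (minn_idPl (ltnW iN)) (eqP (ltnW iN)) (eqP jN) !addr0.
  by apply: sX; rewrite !inordK// ltnS ltnW.
have [iN|Ni] := leqP N i.
  by rewrite ltrD2l ltr_nat ltn_sub2rE.
rewrite (eqP (ltnW Ni)) addr0 ltr_wpDr//.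
by apply: sX; rewrite !inordK ?ltnS// ltnW.
Qed.

Lemma minimizer_extend m n alpha N (X : 'I_N.+1 -> R) : m < n -> 0 < n -> 0 <= alpha ->
  minimizer m n alpha X ->
  seq_minimizer m n N.+1 (interaction_range alpha N.+1) (extend_config X) /\
  min_energy m n alpha N.+1
    = seq_energy m n N.+1 (interaction_range alpha N.+1) (extend_config X).
Proof.
move=> mn n0 a0 Xmin; have [_ P] := min_energyP N.+1 mn n0 a0.
have [sX Xle] := (P X).1 Xmin.
have XE : X = (fun i => extend_config X i) by apply/funext => i; rewrite extend_config_val.
split; last by rewrite -(proj2 Xmin) [in LHS]XE energy_seqE.
split; first exact: extend_config_incr.
move=> z zi; rewrite -!energy_seqE -XE; apply: Xle => i j ij; exact: zi.
Qed.

Lemma minimizer_seqP m n alpha N (X : 'I_N -> R) : m < n -> 0 < n -> 0 <= alpha ->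
  (1 < N)%N -> minimizer m n alpha X ->
  exists y : nat -> R, exists l : nat,
    [/\ seq_minimizer m n N (interaction_range alpha N) y,
        min_energy m n alpha N = seq_energy m n N (interaction_range alpha N) y,
        system_size X = y (N - 1)%N - y 0%N,
        (l.+1 < N)%N /\ min_terrace X = y l.+1 - y l &
        forall l', (l'.+1 < N)%N -> min_terrace X <= y l'.+1 - y l'].
Proof.
move=> mn n0 a0; case: N X => [|[|N]]// X _ Xmin.
have [ymin yE] := minimizer_extend mn n0 a0 Xmin.
set y := extend_config X in ymin yE.
pose terrace (i : 'I_N.+1) := X (lift ord0 i) - X (widen_ord (leqnSn N.+1) i).
have terraceE i : terrace i = y i.+1 - y i.
  rewrite /terrace /y -(extend_config_val X (lift ord0 i)).
  by rewrite -(extend_config_val X (widen_ord _ i)).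
have min_le j : min_terrace X <= terrace j by exact: bigmin_le.
have [i0 i0E] : exists i0, min_terrace X = terrace i0.
  have /bigmin_leP[h|[i _ h]] := lexx (min_terrace X).
    by exists ord0; apply/eqP; rewrite eq_le h min_le.
  by exists i; apply/eqP; rewrite eq_le h min_le.
exists y, i0; split=> //.
- rewrite subn1 /= -(extend_config_val X ord_max) -(extend_config_val X ord0) //.
- by split; [rewrite !ltnS -ltnS|rewrite -terraceE].
- move=> l; rewrite !ltnS => lN.
  have lt : (l < N.+1)%N by rewrite ltnS.
  by rewrite -(terraceE (Ordinal lt)).
Qed.

End Transfer.

(** * Scaling laws in terms of the number of steps *)

Section Laws.
Variable R : realType.
Implicit Types (m n alpha e : R) (N : nat).

Local Notation range alpha N := (interaction_range (R := R) alpha N).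

Lemma interaction_range_bounds alpha N : 0 < alpha <= 1 -> (0 < N)%N ->
  (0 < range alpha N <= N)%N /\
  N%:R `^ alpha / 2 <= (range alpha N)%:R <= N%:R `^ alpha.
Proof.
move=> /andP[a0 a1] N0; have N1 : (1 : R) <= N%:R by rewrite ler1n.
have x1 : 1 <= N%:R `^ alpha by rewrite ge1_powR// ltW.
have /andP[k1 k2] := truncn_itv (powR_ge0 (N%:R : R) alpha).
have K0 : (0 < range alpha N)%N by rewrite truncn_gt0.
rewrite /interaction_range in K0 *; split.
  rewrite K0 -(ler_nat R) (le_trans k1)// ler1_powR//.
rewrite k1 andbT; move: K0; rewrite -(ltr_nat R) => K0.
have K1 : (1 : R) <= (Num.trunc (N%:R `^ alpha))%:R.
  by rewrite ler1n truncn_gt0.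
by rewrite -natr1 in k2; rewrite ler_pdivrMr//; lra.
Qed.

Lemma powR_half_bounds (x k e : R) : 0 <= e -> 0 < x -> x / 2 <= k <= x ->
  2 `^ (- e) * x `^ e <= k `^ e <= x `^ e.
Proof.
move=> e0 x0 /andP[k1 k2]; have k0 : 0 < k by rewrite (lt_le_trans _ k1)// divr_gt0.
apply/andP; split; last by rewrite le_powR_pos// ltW.
rewrite mulrC -powR_divl// le_powR_pos//.
by rewrite divr_ge0 ?(ltW x0).
Qed.

Lemma powR_half_bounds_neg (x k e : R) : 0 <= e -> 0 < x -> x / 2 <= k <= x ->
  x `^ (- e) <= k `^ (- e) <= 2 `^ e * x `^ (- e).
Proof.
move=> e0 x0 /andP[k1 k2]; have k0 : 0 < k by rewrite (lt_le_trans _ k1)// divr_gt0.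
apply/andP; split; first by rewrite le_powR_neg.
have -> : 2 `^ e * x `^ (- e) = (x / 2) `^ (- e).
  by rewrite powR_divl// opprK mulrC.
by rewrite le_powR_neg// divr_gt0.
Qed.

Lemma mul_powR_range alpha e N : 0 < alpha <= 1 -> 0 <= e -> (0 < N)%N ->
  2 `^ (- e) * N%:R `^ (1 + e * alpha) <= N%:R * (range alpha N)%:R `^ e
    <= N%:R `^ (1 + e * alpha).
Proof.
move=> a01 e0 N0; have NR : (0 : R) < N%:R by rewrite ltr0n.
have [_ h] := interaction_range_bounds a01 N0.
have /andP[h1 h2] := powR_half_bounds e0 (powR_gt0 alpha NR) h.
rewrite powRDp// powRr1 ?(ltW NR)// [e * _]mulrC powRrM.
by rewrite mulrCA !ler_pM2l// h1 h2.
Qed.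

Lemma powR_range_neg alpha e N : 0 < alpha <= 1 -> 0 <= e -> (0 < N)%N ->
  N%:R `^ (- (e * alpha)) <= (range alpha N)%:R `^ (- e) <= 2 `^ e * N%:R `^ (- (e * alpha)).
Proof.
move=> a01 e0 N0; have NR : (0 : R) < N%:R by rewrite ltr0n.
have [_ h] := interaction_range_bounds a01 N0.
have := powR_half_bounds_neg e0 (powR_gt0 alpha NR) h.
by rewrite -!powRrM mulrN [alpha * _]mulrC.
Qed.

Lemma energy_law_of_neg m n alpha : -1 < m -> m < 0 -> 1 < n -> 0 < alpha <= 1 ->
  exists c C : R, [/\ 0 < c, 0 < C & forall N (X : 'I_N -> R), (1 < N)%N ->
    minimizer m n alpha X ->
    c * N%:R `^ (1 + (1 - m) * n * alpha / (n - m)) <= min_energy m n alpha N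
      <= C * N%:R `^ (1 + (1 - m) * n * alpha / (n - m))].
Proof.
move=> m1 m0 n1 a01; have /andP[a0 _] := a01.
have [c c0 cP] := energy_ge_of_neg m1 m0 n1.
have [C C0 CP] := min_energy_le_of_neg m1 m0 n1.
pose e := (1 - m) * n / (n - m).
have e0 : 0 <= e by rewrite divr_ge0 ?mulr_ge0//; lra.
exists (c * 2 `^ (- e)), C; split=> //; first by rewrite mulr_gt0 ?powR_gt0.
move=> N X N1 Xmin; have mn : m < n by lra. have n0 : 0 < n by lra.
have [y [l [ymin -> _ _ _]]] := minimizer_seqP mn n0 (ltW a0) N1 Xmin.
have [KN _] := interaction_range_bounds a01 (ltnW N1).
have -> : (1 - m) * n * alpha / (n - m) = e * alpha by rewrite /e; ring.
have /andP[h1 h2] := mul_powR_range a01 e0 (ltnW N1).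
apply/andP; split.
  by rewrite -mulrA; apply: le_trans (cP _ _ _ N1 KN (proj1 ymin)); rewrite ler_pM2l.
by apply: le_trans (CP _ _ _ N1 KN ymin) _; rewrite ler_pM2l.
Qed.

Lemma energy_law_of_pos m n alpha : 0 < m -> m < 1 -> 1 < n -> 0 < alpha <= 1 ->
  exists c C : R, [/\ 0 < c, 0 < C & forall N (X : 'I_N -> R), (1 < N)%N ->
    minimizer m n alpha X ->
    - c * N%:R `^ (1 + (1 - m) * n * alpha / (n - m)) <= min_energy m n alpha N
      <= - C * N%:R `^ (1 + (1 - m) * n * alpha / (n - m))].
Proof.
move=> m0 m1 n1 a01; have /andP[a0 _] := a01.
have [c c0 cP] := energy_ge_of_pos m0 m1 n1.
have [C C0 CP] := min_energy_le_of_pos m0 m1 n1.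
pose e := (1 - m) * n / (n - m).
have e0 : 0 <= e by rewrite divr_ge0 ?mulr_ge0//; lra.
exists c, (C * 2 `^ (- e)); split=> //; first by rewrite mulr_gt0 ?powR_gt0.
move=> N X N1 Xmin; have mn : m < n by lra. have n0 : 0 < n by lra.
have [y [l [ymin -> _ _ _]]] := minimizer_seqP mn n0 (ltW a0) N1 Xmin.
have [KN _] := interaction_range_bounds a01 (ltnW N1).
have -> : (1 - m) * n * alpha / (n - m) = e * alpha by rewrite /e; ring.
have /andP[h1 h2] := mul_powR_range a01 e0 (ltnW N1).
apply/andP; split.
  by apply: le_trans (cP _ _ _ N1 KN (proj1 ymin)); rewrite !mulNr lerN2 ler_pM2l.
apply: le_trans (CP _ _ _ N1 KN ymin) _.
by rewrite !mulNr lerN2 -[leLHS]mulrA ler_pM2l.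
Qed.

(** Replacing pair_count N K * ln K by alpha * N `^ (1 + alpha) * ln N costs
    O(N `^ (1 + alpha)): rounding N `^ alpha to K, and the K ^+ 2 pairs missing
    at the ends of the configuration, which for alpha < 1 are so few that the
    logarithm is absorbed. *)
Lemma energy_law_ln n alpha : 1 < n -> 0 < alpha < 1 ->
  exists2 C : R, 0 < C & forall N (X : 'I_N -> R), (1 < N)%N ->
    minimizer 0 n alpha X ->
    (n - 1) * alpha / n * N%:R `^ (1 + alpha) * ln N%:R - C * N%:R `^ (1 + alpha)
      <= min_energy 0 n alpha N
      <= (n - 1) * alpha / n * N%:R `^ (1 + alpha) * ln N%:R + C * N%:R `^ (1 + alpha).
Proof.
move=> n1 /andP[a0 a1]; have a01 : 0 < alpha <= 1 by rewrite a0 ltW.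
have n10 : 0 < (n - 1)^-1 by rewrite invr_gt0; lra.
have a1i : 0 < (1 - alpha)^-1 by rewrite invr_gt0; lra.
exists (3 + (1 - alpha)^-1 + (n - 1)^-1); first lra.
move=> N X N1 Xmin; have n0 : 0 < n by lra.
have [y [l [ymin -> _ _ _]]] := minimizer_seqP n0 n0 (ltW a0) N1 Xmin.
have [KN hK] := interaction_range_bounds a01 (ltnW N1).
have /andP[B1 B2] := min_energy_bounds_ln n1 N1 KN ymin.
move: KN hK B1 B2; set K := range alpha N; set E := seq_energy _ _ _ _ _.
move=> /andP[K0 KN]; rewrite pair_countE//.
have NR : (1 : R) < N%:R by rewrite ltr1n.
have N0 : (0 : R) < N%:R by lra.
have KR : (1 : R) <= K%:R by rewrite ler1n.
set x := N%:R `^ alpha; set k : R := K%:R in KR *.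
have x0 : 0 < x by rewrite powR_gt0.
move=> /andP[k1 k2]; set M := N%:R * k - k * (k + 1) / 2.
have -> : N%:R `^ (1 + alpha) = N%:R * x by rewrite powRDp// powRr1 ?(ltW N0).
have -> : (n - 1) * alpha / n = (1 - n^-1) * alpha by field; rewrite gt_eqF.
set u := 1 - n^-1.
have u0 : 0 <= u by rewrite subr_ge0 invf_le1// ltW.
have u1 : u <= 1 by rewrite gerBl invr_ge0 ltW.
have Nk : k <= N%:R by rewrite ler_nat.
have M0 : 0 <= M by rewrite /M; nra.
have lx : ln x = alpha * ln N%:R by rewrite ln_powR.
have lx0 : 0 <= ln x by rewrite lx mulr_ge0 ?ln_ge0 ?ltW.
have lk0 : 0 <= ln k by rewrite ln_ge0.
have lkx : ln k <= ln x by rewrite ler_ln ?posrE//; lra.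
have lxk : ln x - 1 <= ln k.
  have l2 : ln 2 <= 1 :> R by apply: le_trans (ln_le_sub1 _) _ => //; lra.
  have : ln (x / 2) <= ln k by rewrite ler_ln ?posrE// ?divr_gt0//; lra.
  rewrite ln_div ?posrE//; lra.
have lxx : ln x <= x by apply/ltW/ln_sublinear.
have xlx : x * ln x <= (1 - alpha)^-1 * N%:R.
  have h := @ln_le_powR R (1 - alpha) N%:R; rewrite subr_gt0 in h.
  have {}h := h a1 N0.
  have xN : x * N%:R `^ (1 - alpha) = N%:R.
    by rewrite /x -powRDp// addrCA subrr addr0 powRr1 ?(ltW N0).
  rewrite lx mulrCA; apply: (@le_trans _ _ (x * ln N%:R)).
    by rewrite ler_piMl ?mulr_ge0 ?(ltW x0) ?ln_ge0 ?ltW.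
  by rewrite -{2}xN mulrCA ler_pM2l.
have NX : 0 <= N%:R * x by rewrite mulr_ge0// ltW.
have MNx : M <= N%:R * x.
  have : N%:R * k <= N%:R * x by rewrite ler_pM2l.
  have : 0 <= k * (k + 1) / 2 by rewrite divr_ge0// mulr_ge0; lra.
  by rewrite /M; lra.
have Mge : N%:R * x - N%:R - x ^+ 2 <= M.
  have : N%:R * (x - 1) <= N%:R * k.
    rewrite ler_pM2l//; have /andP[_] := truncn_itv (powR_ge0 (N%:R : R) alpha).
    by rewrite -natr1 -/(range alpha N) -/K -/k -/x; lra.
  have : k * (k + 1) / 2 <= x ^+ 2 by nra.
  by rewrite /M; lra.
have U : M * ln k <= N%:R * x * ln x by apply: ler_pM.
have L : N%:R * x * ln x - (2 + (1 - alpha)^-1) * (N%:R * x) <= M * ln k.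
  apply: (@le_trans _ _ (M * (ln x - 1))); last by rewrite ler_wpM2l.
  have h1 : (N%:R * x - N%:R - x ^+ 2) * ln x <= M * ln x by rewrite ler_wpM2r.
  have h2 : N%:R * ln x <= N%:R * x by rewrite ler_pM2l.
  have h3 : x ^+ 2 * ln x <= (1 - alpha)^-1 * (N%:R * x).
    have -> : x ^+ 2 * ln x = x * (x * ln x) by ring.
    have -> : (1 - alpha)^-1 * (N%:R * x) = x * ((1 - alpha)^-1 * N%:R) by ring.
    by rewrite ler_pM2l.
  lra.
have -> : u * alpha * (N%:R * x) * ln N%:R = u * (N%:R * x * ln x) by rewrite lx; ring.
move=> B1 B2; apply/andP; split.
  apply: le_trans B1.
  have h1 := ler_wpM2l u0 L.
  have Nkx : N%:R * k <= N%:R * x by rewrite ler_pM2l.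
  have h2 : u * ((2 + (1 - alpha)^-1) * (N%:R * x)) <= (2 + (1 - alpha)^-1) * (N%:R * x).
    by rewrite ler_piMl// mulr_ge0//; lra.
  have h3 : 0 <= (n - 1)^-1 * (N%:R * x) by rewrite mulr_ge0// ltW.
  lra.
apply: le_trans B2 _.
have h1 := ler_wpM2l u0 U.
have h2 : (n - 1)^-1 * (N%:R * k) <= (n - 1)^-1 * (N%:R * x).
  by rewrite ler_pM2l// ler_pM2l.
have h3 : 0 <= (3 + (1 - alpha)^-1) * (N%:R * x) by rewrite mulr_ge0//; lra.
lra.
Qed.

(** Here all pairs interact and pair_count N N = N (N - 1) / 2. *)
Lemma energy_law_ln1 n : 1 < n ->
  exists2 C : R, 0 < C & forall N (X : 'I_N -> R), (1 < N)%N ->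
    minimizer 0 n 1 X ->
    (n - 1) / (2 * n) * N%:R ^+ 2 * ln N%:R - C * N%:R ^+ 2
      <= min_energy 0 n 1 N
      <= (n - 1) / (2 * n) * N%:R ^+ 2 * ln N%:R + C * N%:R ^+ 2.
Proof.
move=> n1; have n10 : 0 < (n - 1)^-1 by rewrite invr_gt0; lra.
exists (2 + (n - 1)^-1); first lra.
move=> N X N1 Xmin; have n0 : 0 < n by lra.
have a01 : 0 < (1 : R) <= 1 by rewrite ltr01 lexx.
have [y [l [ymin -> _ _ _]]] := minimizer_seqP n0 n0 ler01 N1 Xmin.
have KE : range 1 N = N by rewrite /interaction_range powRr1// natrK.
have [KN _] := interaction_range_bounds a01 (ltnW N1).
have /andP[B1 B2] := min_energy_bounds_ln n1 N1 KN ymin.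
move: B1 B2; rewrite !KE; set E := seq_energy _ _ _ _ _; rewrite pair_countE//.
have NR : (1 : R) < N%:R by rewrite ltr1n.
have l0 : 0 <= ln (N%:R : R) by rewrite ln_ge0// ltW.
have l1 : ln (N%:R : R) <= N%:R by apply/ltW/ln_sublinear; lra.
set x : R := N%:R in NR l0 l1 *; set L := ln x in l0 l1 *.
have -> : (n - 1) / (2 * n) = (1 - n^-1) / 2 by field; rewrite gt_eqF.
set u := 1 - n^-1.
have u0 : 0 <= u by rewrite subr_ge0 invf_le1// ltW.
have u1 : u <= 1 by rewrite gerBl invr_ge0 ltW.
have -> : u * ((x * x - x * (x + 1) / 2) * L) = u / 2 * x ^+ 2 * L - u * (x * L) / 2 by field.
have h0 : 0 <= x * L by rewrite mulr_ge0//; lra.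
have h1 : u * (x * L) <= x * L by rewrite ler_piMl.
have h2 : 0 <= u * (x * L) by rewrite mulr_ge0.
have h3 : x * L <= x ^+ 2 by rewrite expr2 ler_pM2l//; lra.
have h4 : 0 <= (n - 1)^-1 * x ^+ 2 by rewrite mulr_ge0 ?sqr_ge0// ltW.
have h5 : 0 <= x ^+ 2 by exact: sqr_ge0.
by move=> B1 B2; rewrite -!expr2 in B1 B2; apply/andP; split; lra.
Qed.

Lemma terrace_ge m n alpha : -1 < m -> m < 1 -> 1 < n -> 0 < alpha <= 1 ->
  exists2 c : R, 0 < c & forall N (X : 'I_N -> R), (1 < N)%N ->
    minimizer m n alpha X ->
    c * N%:R `^ (- ((1 - m) * alpha / (n - m))) <= min_terrace X.
Proof.
move=> m1 m2 n1 a01; have /andP[a0 _] := a01.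
exists (Num.min 1 (1 - m) `^ (n - m)^-1); first by rewrite powR_gt0 ?min1B_gt0.
move=> N X N1 Xmin; have mn : m < n by lra. have n0 : 0 < n by lra.
have [y [l [ymin _ _ [lN ->] lmin]]] := minimizer_seqP mn n0 (ltW a0) N1 Xmin.
have [/andP[K0 _] _] := interaction_range_bounds a01 (ltnW N1).
apply: le_trans (smallest_gap_ge m1 m2 n1 K0 ymin lN lmin).
rewrite ler_wpM2l ?powR_ge0//.
have e0 : 0 <= (1 - m) / (n - m) by rewrite divr_ge0//; lra.
have /andP[h _] := powR_range_neg a01 e0 (ltnW N1).
by rewrite (_ : (1 - m) * alpha / _ = (1 - m) / (n - m) * alpha)//; ring.
Qed.

Lemma terrace_le m n alpha : -1 < m -> m < 1 -> 1 < n -> 0 < alpha <= 1 ->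
  exists2 C : R, 0 < C & forall N (X : 'I_N -> R), (1 < N)%N ->
    minimizer m n alpha X ->
    min_terrace X <= C * N%:R `^ (- ((1 - m) * alpha / (n - m))).
Proof.
move=> m1 m2 n1 a01; have /andP[a0 _] := a01.
have [C C0 CP] : exists2 C : R, 0 < C & forall N K y lam, (1 < N)%N -> (0 < K <= N)%N ->
    seq_minimizer m n N K y -> 0 < lam ->
    (forall l, (l.+1 < N)%N -> lam <= y l.+1 - y l) ->
    lam <= C * K%:R `^ (- ((1 - m) / (n - m))).
  have [m0|m0|m0] := ltgtP m 0.
  - exact: smallest_gap_le_of_neg.
  - exact: smallest_gap_le_of_pos.
  - exists (expR (12 * (1 + (n - 1)^-1))); first exact: expR_gt0.
    rewrite m0 !subr0 div1r; exact: smallest_gap_le_ln.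
exists (C * 2 `^ ((1 - m) / (n - m))); first by rewrite mulr_gt0 ?powR_gt0.
move=> N X N1 Xmin; have mn : m < n by lra. have n0 : 0 < n by lra.
have [y [l [ymin _ _ [lN lE] lmin]]] := minimizer_seqP mn n0 (ltW a0) N1 Xmin.
have [KN _] := interaction_range_bounds a01 (ltnW N1).
have lam0 : 0 < min_terrace X by rewrite lE; exact: gap_gt0 (proj1 ymin) l.
apply: le_trans (CP _ _ _ _ N1 KN ymin lam0 lmin) _.
rewrite -mulrA ler_pM2l//.
have e0 : 0 <= (1 - m) / (n - m) by rewrite divr_ge0//; lra.
have /andP[_ h] := powR_range_neg a01 e0 (ltnW N1).
by rewrite (_ : (1 - m) * alpha / _ = (1 - m) / (n - m) * alpha)//; ring.
Qed.

Lemma size_ge m n alpha : -1 < m -> m < 1 -> 1 < n -> 0 < alpha <= 1 ->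
  exists2 c : R, 0 < c & forall N (X : 'I_N -> R), (1 < N)%N ->
    minimizer m n alpha X ->
    c * N%:R `^ (1 - (1 - m) * alpha / (n - m)) <= system_size X.
Proof.
move=> m1 m2 n1 a01; have /andP[a0 _] := a01.
have [c c0 cP] := terrace_ge m1 m2 n1 a01.
exists (c / 2); first by rewrite divr_gt0.
move=> N X N1 Xmin; have mn : m < n by lra. have n0 : 0 < n by lra.
have h := cP N X N1 Xmin.
have [y [l [ymin _ -> _ lmin]]] := minimizer_seqP mn n0 (ltW a0) N1 Xmin.
have NR : (2 : R) <= N%:R by rewrite ler_nat.
have N0 : (0 : R) < N%:R by lra.
have N1N : (0 + (N - 1) < N)%N by rewrite add0n subn1 prednK ?(ltnW N1).
have := distance_ge lmin N1N; rewrite add0n.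
apply: le_trans.
rewrite powRDp// powRr1 ?(ltW N0)// natrB ?(ltnW N1)//.
set P := _ `^ _ in h *; have P0 : 0 <= P by exact: powR_ge0.
apply: (@le_trans _ _ ((N%:R - 1) * (c * P))); last by rewrite ler_wpM2l//; lra.
have cP0 : 0 <= c * P by rewrite mulr_ge0// ltW.
have -> : c / 2 * (N%:R * P) = N%:R / 2 * (c * P) by ring.
by rewrite ler_wpM2r//; lra.
Qed.

(** The exponent s balances the small gaps, N * L `^ (- s), against the crowded
    ones, N / L `^ s with nu = L `^ s, for del = L `^ (- s); any power of N
    smaller than N `^ alpha serves for L, here its square root. *)
Lemma size_le m n alpha : -1 < m -> m < 1 -> 1 < n -> 0 < alpha <= 1 ->
  exists C beta : R, [/\ 0 < C, 0 < beta & forall N (X : 'I_N -> R), (1 < N)%N ->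
    4 <= N%:R `^ (alpha / 2) ->
    minimizer m n alpha X ->
    system_size X <= C * N%:R `^ (1 - beta)].
Proof.
move=> m1 m2 n1 a01; have /andP[a0 a1] := a01.
pose s := (1 - m) / (n + 3).
have s0 : 0 < s by rewrite divr_gt0//; lra.
have s1 : s <= 1 by rewrite ler_pdivrMr; lra.
pose c : R := (1 - 2 `^ (m - n)) * 2 `^ (- m - 2).
have mn : m < n by lra. have n0 : 0 < n by lra.
have c0 : 0 < c.
  rewrite mulr_gt0 ?powR_gt0// subr_gt0 powR_expR// -[ltRHS]expR0 ltr_expR.
  by rewrite pmulr_llt0 ?subr_lt0// ln_gt0// ltr1n.
pose sc := Num.sqrt c; have sc0 : 0 < sc by rewrite sqrtr_gt0.
pose D := 1 + 5 / sc; have D0 : 0 < D by rewrite addr_gt0 ?divr_gt0.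
pose beta := s * (alpha / 2).
have beta0 : 0 < beta by rewrite mulr_gt0// divr_gt0.
exists (2 + D * 2 `^ s), beta; split => //.
  by rewrite addr_gt0// mulr_gt0// powR_gt0.
move=> N X N1 x4 Xmin.
have [y [l [ymin _ -> _ _]]] := minimizer_seqP mn n0 (ltW a0) N1 Xmin.
have [/andP[K0 KN] /andP[K1 _]] := interaction_range_bounds a01 (ltnW N1).
have NR : (1 : R) < N%:R by rewrite ltr1n.
have N0 : (0 : R) < N%:R by lra.
set x := N%:R `^ (alpha / 2) in x4.
have x0 : 0 < x by lra.
have xx : N%:R `^ alpha = x ^+ 2.
  by rewrite -powR_mulrn ?(ltW x0)// /x -powRrM divfK.
pose L := Num.trunc x.
have /andP[L1 L2] := truncn_itv (ltW x0); rewrite -/L -natr1 in L1 L2.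
have LR : (0 : R) < L%:R by lra.
have L0 : (0 < L)%N by rewrite -(ltr_nat R).
have LK : (L.*2 <= range alpha N)%N.
  rewrite -(ler_nat R) -muln2 natrM; apply: le_trans K1; rewrite xx; nra.
have LN := leq_trans LK KN.
have del01 : 0 < (L%:R : R) `^ (- s) <= 1.
  have := @le_powR_neg R s 1 L%:R (ltW s0) ltr01; rewrite powR1 ler1n powR_gt0//=.
  by apply.
have nu0 : 0 < sc * L%:R `^ s by rewrite mulr_gt0// powR_gt0.
have nuE : (sc * L%:R `^ s) ^+ 2
    <= c * ((L%:R `^ (- s)) `^ (n + 1) * L%:R `^ (1 - m)).
  rewrite exprMn sqr_sqrtr ?(ltW c0)// ler_pM2l// -powRrM -powRDp//.
  rewrite -powR_mulrn ?powR_ge0// -powRrM le_eqVlt; apply/orP; left; apply/eqP.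
  by congr (_ `^ _); rewrite /s; field; rewrite gt_eqF//; lra.
have h := minimizer_size_le m1 mn n0 K0 (proj1 ymin) (proj2 ymin) L0 LK LN del01 nu0 nuE.
apply: le_trans h _.
have -> : 2 * L%:R + N%:R * L%:R `^ (- s) + 5 * N%:R / (sc * L%:R `^ s)
    = 2 * L%:R + D * (N%:R * L%:R `^ (- s)).
  by rewrite powRN /D; field; rewrite !gt_eqF// powR_gt0.
rewrite [leRHS]mulrDl; apply: lerD.
  rewrite ler_pM2l//; apply: le_trans L1 _; rewrite ler_powR ?(ltW NR)//.
  rewrite /beta; nra.
rewrite -mulrA ler_pM2l// powRDp// powRr1 ?(ltW N0)// mulrCA ler_pM2l//.
have Lx : x / 2 <= L%:R <= x by apply/andP; split; lra.
have /andP[_] := powR_half_bounds_neg (ltW s0) x0 Lx.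
by rewrite /x -powRrM mulrN [alpha / 2 * s]mulrC.
Qed.

End Laws.

(** * The scaling laws for minimizers *)

Lemma cvg_powR_neg (R : realType) (e : R) : 0 < e ->
  (fun N : nat => N%:R `^ (- e)) @ \oo --> (0 : R).
Proof.
move=> e0; apply/cvgrPdist_le => eps eps0; near=> N.
have NR : (0 : R) < N%:R by rewrite ltr0n; near: N; exact: nbhs_infty_gt.
rewrite sub0r normrN ger0_norm ?powR_ge0//.
have h : eps `^ (- e^-1) <= N%:R by near: N; exact: nbhs_infty_ger.
have -> : eps = (eps `^ (- e^-1)) `^ (- e).
  by rewrite -powRrM mulrNN mulVf ?gt_eqF// powRr1// ltW.
by rewrite le_powR_neg ?powR_gt0// ltW.
Unshelve. all: by end_near. Qed.

(** In the logarithmic case the error terms are of order N `^ (1 + alpha), and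
    ln (ln N) >= 1. *)
Lemma energy_laws (R : realType) (m n alpha : R) :
  -1 < m -> m < 1 -> 1 < n -> 0 < alpha <= 1 ->
  exists cA CA : R, [/\ 0 < cA, 0 < CA &
    forall (N : nat) (X : 'I_N -> R), (1 < N)%N -> 1 <= ln (ln (N%:R : R)) ->
    minimizer m n alpha X ->
    [/\ m < 0 ->
          cA * N%:R `^ (1 + (1 - m) * n * alpha / (n - m))
            <= min_energy m n alpha N
            <= CA * N%:R `^ (1 + (1 - m) * n * alpha / (n - m)),
        m = 0 -> alpha < 1 ->
          (n - 1) * alpha / n * N%:R `^ (1 + alpha) * ln N%:R
              - cA * N%:R `^ (1 + alpha) * ln (ln N%:R)
            <= min_energy m n alpha N
            <= (n - 1) * alpha / n * N%:R `^ (1 + alpha) * ln N%:R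
              + CA * N%:R `^ (1 + alpha),
        m = 0 -> alpha = 1 ->
          (n - 1) / (2 * n) * N%:R ^+ 2 * ln N%:R
              - cA * N%:R ^+ 2 * ln (ln N%:R)
            <= min_energy m n alpha N
            <= (n - 1) / (2 * n) * N%:R ^+ 2 * ln N%:R + CA * N%:R ^+ 2 &
        0 < m ->
          - cA * N%:R `^ (1 + (1 - m) * n * alpha / (n - m))
            <= min_energy m n alpha N
            <= - CA * N%:R `^ (1 + (1 - m) * n * alpha / (n - m))]].
Proof.
move=> hm hm1 hn a01; have /andP[ha0 ha1] := a01.
have [m0|m0|m0] := ltgtP m 0.
- have [c [C [c0 C0 P]]] := energy_law_of_neg hm m0 hn a01.
  exists c, C; split=> // N X N1 _ Xmin; split=> [_|E|E|]//.
  + exact: P Xmin.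
  + by move: m0; rewrite E ltxx.
  + by move: m0; rewrite E ltxx.
- have [c [C [c0 C0 P]]] := energy_law_of_pos m0 hm1 hn a01.
  exists c, C; split=> // N X N1 _ Xmin; split=> [|E|E|_]//.
  + by move: m0; rewrite E ltxx.
  + by move: m0; rewrite E ltxx.
  + exact: P Xmin.
- rewrite m0 in hm hm1 *; have [a1|a1] := eqVneq alpha 1.
    rewrite a1; have [C C0 P] := energy_law_ln1 (n := n) hn.
    exists C, C; split=> // N X N1 ll Xmin; split; rewrite ?ltxx// => _ _.
    have /andP[h1 h2] := P N X N1 Xmin; rewrite h2 andbT.
    apply: le_trans h1; rewrite lerD2l lerN2 ler_peMr//.
    by rewrite mulr_ge0 ?sqr_ge0// ltW.
  have al1 : 0 < alpha < 1 by rewrite ha0 lt_neqAle a1.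
  have [C C0 P] := energy_law_ln hn al1.
  exists C, C; split=> // N X N1 ll Xmin.
  split; rewrite ?ltxx// => _ E; last by rewrite E eqxx in a1.
  have /andP[h1 h2] := P N X N1 Xmin; rewrite h2 andbT.
  apply: le_trans h1; rewrite lerD2l lerN2 ler_peMr//.
  by rewrite mulr_ge0 ?powR_ge0// ltW.
Qed.

Theorem theorem1 (R : realType) (m n alpha : R)
    (hm : -1 < m) (hm1 : m < 1) (hn : 1 < n)
    (ha0 : 0 < alpha) (ha1 : alpha <= 1) :
  (exists (cA CA cB CB cC CC beta : R) (N0 : nat),
    [/\ [/\ 0 < cA, 0 < CA, 0 < cB & 0 < CB],
        [/\ 0 < cC, 0 < CC, 0 < beta & (0 < N0)%N] &
    forall (N : nat) (X : 'I_N -> R),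
      (N0 < N)%N -> minimizer m n alpha X ->
      [/\
       (* energy scaling law *)
       [/\ m < 0 ->
             cA * N%:R `^ (1 + (1 - m) * n * alpha / (n - m))
               <= min_energy m n alpha N
               <= CA * N%:R `^ (1 + (1 - m) * n * alpha / (n - m)),
           m = 0 -> alpha < 1 ->
             (n - 1) * alpha / n * N%:R `^ (1 + alpha) * ln N%:R
                 - cA * N%:R `^ (1 + alpha) * ln (ln N%:R)
               <= min_energy m n alpha N
               <= (n - 1) * alpha / n * N%:R `^ (1 + alpha) * ln N%:R
                 + CA * N%:R `^ (1 + alpha),
           m = 0 -> alpha = 1 ->
             (n - 1) / (2 * n) * N%:R ^+ 2 * ln N%:R
                 - cA * N%:R ^+ 2 * ln (ln N%:R)
               <= min_energy m n alpha N
               <= (n - 1) / (2 * n) * N%:R ^+ 2 * ln N%:R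
                 + CA * N%:R ^+ 2 &
           0 < m ->
             - cA * N%:R `^ (1 + (1 - m) * n * alpha / (n - m))
               <= min_energy m n alpha N
               <= - CA * N%:R `^ (1 + (1 - m) * n * alpha / (n - m))],
       (* minimal terrace length *)
       (m != 0 ->
          cB * N%:R `^ (- ((1 - m) * alpha / (n - m)))
            <= min_terrace X
            <= CB * N%:R `^ (- ((1 - m) * alpha / (n - m)))) /\
       (m = 0 ->
          cB * N%:R `^ (- (alpha / n)) * ln N%:R `^ (- n^-1)
            <= min_terrace X
            <= CB * N%:R `^ (- (alpha / n))) &
       (* system size *)
       (m != 0 ->
          cC * N%:R `^ (1 - (1 - m) * alpha / (n - m))
            <= system_size X
            <= CC * N%:R `^ (1 - beta)) /\
       (m = 0 ->
          cC * N%:R `^ (1 - alpha / n) * ln N%:R `^ (- n^-1)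
            <= system_size X
            <= CC * N%:R `^ (1 - beta))]]) /\
  (forall X : forall N, 'I_N -> R, minimizer_sequence m n alpha X ->
     (fun N => min_terrace (X N)) @ \oo --> (0 : R)) /\
  bunching_regime m n alpha.
Proof.
have a01 : 0 < alpha <= 1 by rewrite ha0.
have a0 : 0 <= alpha by exact: ltW.
have mn : m < n by lra.
have n0 : 0 < n by lra.
have [cB cB0 cBP] := terrace_ge hm hm1 hn a01.
have [CB CB0 CBP] := terrace_le hm hm1 hn a01.
have [cC cC0 cCP] := size_ge hm hm1 hn a01.
have [CC [beta [CC0 beta0 CCP]]] := size_le hm hm1 hn a01.
pose gam := (1 - m) * alpha / (n - m).
have gam0 : 0 < gam by rewrite !mulr_gt0 ?invr_gt0//; lra.
(* beyond N0, the size bound applies and ln (ln N) >= 1 *)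
pose bound : R := Num.max (4 `^ (2 / alpha)) (expR (expR 1)).
pose N0 := (Num.trunc bound).+1.
have N0P (N : nat) : (N0 < N)%N ->
    [/\ (1 < N)%N, 4 <= N%:R `^ (alpha / 2) & expR (expR 1) <= (N%:R : R)].
  move=> N0N; have N1 : (1 < N)%N by exact: leq_ltn_trans N0N.
  have bN : bound <= N%:R.
    apply/ltW; apply: lt_le_trans (truncnS_gt bound) _; rewrite ler_nat; exact: ltnW.
  move: bN; rewrite ge_max => /andP[b1 b2]; split=> //.
  have h : 0 <= alpha / 2 by rewrite divr_ge0.
  have := le_powR_pos h (powR_ge0 _ _) b1.
  rewrite -powRrM (_ : 2 / alpha * (alpha / 2) = 1) ?powRr1//.
  by field; rewrite gt_eqF.
have lnN (N : nat) : expR (expR 1) <= (N%:R : R) ->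
    1 <= ln (N%:R : R) /\ 1 <= ln (ln (N%:R : R)).
  move=> h; have NR : 0 < (N%:R : R) by apply: lt_le_trans h; exact: expR_gt0.
  have h1 : expR 1 <= ln (N%:R : R).
    by rewrite -[leLHS]expRK ler_ln ?posrE ?expR_gt0.
  have e1 : 1 <= expR (1 : R) by rewrite -[leLHS]expR0 ler_expR.
  split; first exact: le_trans h1.
  by rewrite -[leLHS]expRK ler_ln ?posrE ?expR_gt0//; exact: lt_le_trans (expR_gt0 _) h1.
have ln_le1 (N : nat) : expR (expR 1) <= (N%:R : R) ->
    0 <= ln (N%:R : R) `^ (- n^-1) <= 1.
  move=> /lnN[h _]; rewrite powR_ge0/=.
  have ni : 0 <= n^-1 by rewrite invr_ge0 ltW.
  by have := le_powR_neg ni ltr01 h; rewrite powR1.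
split; last split.
- have [cA [CA [cA0 CA0 AP]]] := energy_laws hm hm1 hn a01.
  exists cA, CA, cB, CB, cC, CC, beta, N0; split=> // N X N0N Xmin.
  have [N1 N4 Ne] := N0P N N0N.
  have [_ ll] := lnN N Ne; have /andP[l0 l1] := ln_le1 N Ne.
  have gE : m = 0 -> (1 - m) * alpha / (n - m) = alpha / n.
    by move=> ->; rewrite !subr0 mul1r.
  have B1 := cBP N X N1 Xmin; have B2 := CBP N X N1 Xmin.
  have C1 := cCP N X N1 Xmin; have C2 := CCP N X N1 N4 Xmin.
  split; [exact: (AP N X N1 ll Xmin)|split=> [_|m0]|split=> [_|m0]].
  + by rewrite B1.
  + rewrite -(gE m0) B2 andbT; apply: le_trans B1.
    by rewrite ler_piMr// mulr_ge0 ?powR_ge0// ltW.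
  + by rewrite C1.
  + rewrite -(gE m0) C2 andbT; apply: le_trans C1.
    by rewrite ler_piMr// mulr_ge0 ?powR_ge0// ltW.
- move=> X Xmin.
  apply: (@squeeze_cvgr _ _ _ _ (fun=> 0) (fun N : nat => CB * N%:R `^ (- gam))).
  + near=> N; have N1 : (1 < N)%N by near: N; exact: nbhs_infty_gt.
    apply/andP; split; last exact: CBP.
    apply: le_trans (cBP N (X N) N1 (Xmin N)).
    by rewrite mulr_ge0 ?powR_ge0// ltW.
  + exact: cvg_cst.
  + rewrite -[X in _ --> X](mulr0 CB); apply: cvgMl_tmp; exact: cvg_powR_neg.
- move=> X Xmin; rewrite /bunching_sequence.
  apply: (cvg_limn_einf_sup _).2.
  apply/fine_cvgP; split; first by near=> N.
  apply: (@squeeze_cvgr _ _ _ _ (fun=> 0) (fun N : nat => CC * N%:R `^ (- beta))).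
  + near=> N; have N0N : (N0 < N)%N by near: N; exact: nbhs_infty_gt.
    have [N1 N4 _] := N0P N N0N.
    have NR : (0 : R) < N%:R by rewrite ltr0n ltnW.
    have C1 := cCP N (X N) N1 (Xmin N); have C2 := CCP N (X N) N1 N4 (Xmin N).
    rewrite /=; apply/andP; split.
      rewrite divr_ge0// (le_trans _ C1)// mulr_ge0 ?powR_ge0// ltW//.
    rewrite ler_pdivrMr//; apply: le_trans C2 _.
    by rewrite powRDp// powRr1 ?(ltW NR)// [N%:R * _]mulrC mulrA.
  + exact: cvg_cst.
  + rewrite -[X in _ --> X](mulr0 CC); apply: cvgMl_tmp; exact: cvg_powR_neg.
Unshelve. all: by end_near. Qed.
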